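(* Let $M$ be a compact connected $d$-dimensional Riemannian manifold ($d \geqslant 1$, smooth, without boundary) and let $0 < s < d$. Let $\mathcal{X} = (X_1, X_2, \ldots)$ be a well separated admissible sequence of $M$-codes, and let $\delta$ be the discrepancy function used to satisfy the admissibility condition, so that $\mathcal{D}(X_\ell) < \delta(|X_\ell|)$ for all $\ell$. Then the normalized Riesz $s$-energy of $X_\ell$ converges to the energy double integral of the normalized volume measure $\sigma_M$ as $|X_\ell| \to \infty$, with $$\left| \big(\operatorname{E}_{X_\ell} - \operatorname{E}_M\big)\, U^{(s)} \right| = O\!\left( \delta(|X_\ell|)^{(1-s/d)/(d+2-s/d)} \right) \quad \text{as } |X_\ell| \to \infty,$$ and therefore $$\left| \big(\operatorname{E}_{X_\ell} - \operatorname{E}_M\big)\, U^{(s)} \right| \to 0 \quad \text{as } |X_\ell| \to \infty.$$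
   Context: All Riemannian manifolds are finite dimensional, smooth and without boundary. For a compact connected $d$-dimensional Riemannian manifold $M$ with metric $g$, $\operatorname{dist}$ is the geodesic distance, $\lambda_M$ is the Riemannian volume measure, $\sigma_M := \lambda_M/\lambda_M(M)$ is the normalized volume (probability) measure, and $B(x,r)$ is the geodesic ball of radius $r$ about $x$. An $M$-code is a finite subset $X$ of $M$; $|X|$ is its cardinality. A sequence $\mathcal{X} = (X_1, X_2, \ldots)$ of $M$-codes is pre-admissible if its cardinalities $N_\ell := |X_\ell|$ diverge to $+\infty$. The normalized ball discrepancy of an $M$-code $X$ is $$\mathcal{D}(X) := \sup_{y \in M,\ r > 0} \left| \frac{|B(y,r) \cap X|}{|X|} - \sigma_M\big(B(y,r)\big) \right|.$$ A pre-admissible sequence is admissible if there exist: a discrepancy function $\delta : \mathbb{N} \to (0,1]$, positive and decreasing with $\delta(N) \to 0$ as $N \to \infty$, such that $\mathcal{D}(X_\ell) < \delta(N_\ell)$ for all $\ell$; and a separation function $\Delta : \mathbb{N} \to (0,\infty)$, positive and decreasing with $\Delta(N) \to 0$ as $N \to \infty$, such that $\operatorname{dist}(x,y) > \Delta(N_\ell)$ for all distinct $x,y \in X_\ell$ and all $\ell$. The sequence is well separated, with separation constant $\gamma > 0$, if the separation bound holds with $\Delta(N_\ell) = \gamma N_\ell^{-1/d}$. The Riesz potential function is $U^{(s)}(r) := r^{-s}$ for $r \in (0,\infty)$. For $u : (0,\infty) \to \mathbb{R}$, the normalized discrete energy of an $M$-code $X$ and the normalized continuous energy are $$\operatorname{E}_X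 u := \frac{1}{|X|^2} \sum_{x \in X} \sum_{\substack{y \in X \\ y \neq x}} u\big(\operatorname{dist}(x,y)\big), \qquad \operatorname{E}_M u := \int_M \int_M u\big(\operatorname{dist}(x,y)\big)\, d\sigma_M(y)\, d\sigma_M(x).$$ $\operatorname{E}_X U^{(s)}$ is the normalized Riesz $s$-energy of $X$, and $\operatorname{E}_M U^{(s)}$ is the energy double integral. *)

(* Defs.v *)
From HB Require Import structures.
From mathcomp Require Import all_boot all_order all_algebra finmap.
From mathcomp Require Import all_classical all_reals all_analysis.
Import Order.TTheory GRing.Theory Num.Theory.
Import numFieldNormedType.Exports.

Set Implicit Arguments.
Unset Strict Implicit.
Unset Printing Implicit Defensive.

Local Open Scope classical_set_scope.
Local Open Scope ring_scope.

Notation borel T := (g_sigma_algebraType (@open T)).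

(* Lebesgue measure on R^n, as the n-fold product of lebesgue_measure. *)
Fixpoint lebesgue_rV (R : realType) (n : nat) : set (borel 'rV[R]_n) -> \bar R :=
  match n with
  | 0 => @dirac _ (borel 'rV[R]_0) 0 R
  | m.+1 => fun A => product_measure1 lebesgue_measure (lebesgue_rV (n := m))
      [set p | A (row_mx (p.1)%:M p.2 : 'rV[R]_(1 + m))]
  end.

(* f is C^k on the open set U; for finite-dimensional V, taking directional   *)
(* derivatives along all v amounts to taking partial derivatives.             *)
Fixpoint Ck_on (R : realType) (V W : normedModType R) (k : nat) (U : set V)
    (f : V -> W) : Prop :=
  (forall x, U x -> {for x, continuous f}) /\
  match k with
  | 0 => True
  | k'.+1 => forall v, (forall x, U x -> derivable f x v) /\
                       Ck_on k' U (fun x => 'D_v f x)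
  end.

Definition smooth_on (R : realType) (V W : normedModType R) (U : set V)
  (f : V -> W) : Prop := forall k, Ck_on k U f.

(* A smooth d-dimensional Riemannian manifold without boundary: a smooth      *)
(* atlas on M together with, for each chart i, the matrix-valued function     *)
(* metric i on the image of the chart giving the metric in the coordinates    *)
(* of i.  With the row-vector convention 'D_v f p = v *m 'J f p, a change of   *)
(* coordinates with Jacobian J turns g_j into J *m g_j *m J^T.                *)
Record riemannian_manifold (R : realType) (d : nat) (M : ptopologicalType) :=
  RiemannianManifold {
  chart_index : Type;
  chart_dom : chart_index -> set M;
  chart : chart_index -> M -> 'rV[R]_d;
  chart_inv : chart_index -> 'rV[R]_d -> M;
  chart_at : M -> chart_index;
  metric : chart_index -> 'rV[R]_d -> 'M[R]_d;

  manifold_hausdorff : hausdorff_space M;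
  manifold_second_countable : @second_countable M;
  chart_dom_open : forall i, open (chart_dom i);
  chart_img_open : forall i, open (chart i @` chart_dom i);
  chart_continuous : forall i x, chart_dom i x -> {for x, continuous (chart i)};
  chart_inv_continuous : forall i p, (chart i @` chart_dom i) p ->
    {for p, continuous (chart_inv i)};
  chartK : forall i x, chart_dom i x -> chart_inv i (chart i x) = x;
  chart_at_dom : forall x, chart_dom (chart_at x) x;
  transition_smooth : forall i j,
    smooth_on (chart i @` (chart_dom i `&` chart_dom j))
      (chart j \o chart_inv i);

  metric_smooth : forall i, smooth_on (chart i @` chart_dom i) (metric i);
  metric_sym : forall i p, (chart i @` chart_dom i) p ->
    (metric i p)^T = metric i p;
  metric_pos : forall i p, (chart i @` chart_dom i) p ->
    forall v : 'rV[R]_d, v != 0 -> 0 < (v *m metric i p *m v^T) 0 0;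
  metric_transition : forall i j x, chart_dom i x -> chart_dom j x ->
    let J := 'J (chart j \o chart_inv i) (chart i x) in
    metric i (chart i x) = J *m metric j (chart j x) *m J^T
}.

Arguments chart_dom {R d M} r _ _.
Arguments chart {R d M} r _ _.
Arguments chart_inv {R d M} r _ _.
Arguments metric {R d M} r _ _.

Section geodesic_distance.
Context (R : realType) (d : nat) (M : ptopologicalType)
        (g : riemannian_manifold R d M).

Definition C1_curve (c : R -> M) : Prop :=
  continuous c /\
  forall i, Ck_on 1 (c @^-1` chart_dom g i) (chart g i \o c).

(* The norm |c'(t)|_g; it does not depend on the chart around c t. *)
Definition speed (c : R -> M) (t : R) : R :=
  let i := chart_at g (c t) in
  let v := 'D_1 (chart g i \o c) t in
  Num.sqrt ((v *m metric g i (chart g i (c t)) *m v^T) 0 0).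

(* A piecewise C^1 curve from x to y is a list of consecutive C^1 curves,     *)
(* each one being run through on [0, 1].                                      *)
Fixpoint piecewise_C1_from_to (s : seq (R -> M)) (x y : M) : Prop :=
  match s with
  | [::] => x = y
  | c :: s' => [/\ C1_curve c, c 0 = x & piecewise_C1_from_to s' (c 1) y]
  end.

Definition curve_length (s : seq (R -> M)) : R :=
  \sum_(c <- s) \int[lebesgue_measure]_(t in `[0, 1]) speed c t.

Definition geodist (x y : M) : R :=
  inf [set curve_length s | s in [set s | piecewise_C1_from_to s x y]].

Definition geoball (x : M) (r : R) : set M := [set y | geodist x y < r].

(* lambda is the Riemannian volume measure: dV = sqrt (det g_i) dx in every   *)
(* chart i.  As M is second countable, this determines lambda.                *)
Definition riemannian_volume (lambda : {measure set (borel M) -> \bar R}) :=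
  forall i (A : set (borel M)), measurable A -> A `<=` chart_dom g i ->
    (lambda A = \int[@lebesgue_rV R d]_(p in chart g i @` A)
                  (Num.sqrt (\det (metric g i p)))%:E)%E.

End geodesic_distance.

(* The fallback argument of mnormalize is used only when lambda setT is 0 or  *)
(* +oo, which does not happen for the volume measure of a compact manifold.   *)
Definition normalized_volume (R : realType) (M : ptopologicalType)
    (lambda : {measure set (borel M) -> \bar R}) : probability (borel M) R :=
  mnormalize lambda point.

Section codes.
Context (R : realType) (d : nat) (M : ptopologicalType)
        (g : riemannian_manifold R d M)
        (lambda : {measure set (borel M) -> \bar R}).
Implicit Types (Y : {fset M}) (X : nat -> {fset M}).

Local Notation sigma := (normalized_volume lambda).

Definition discrepancy Y : R :=
  sup [set D | exists y r, 0 < r /\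
    D = `| #|` [fset x in Y | x \in geoball g y r]%fset|%:R / #|` Y|%:R
           - fine (sigma (geoball g y r)) | ].

Definition preadmissible X : Prop := (fun l => #|` X l|) @ \oo --> \oo.

(* delta and Delta are functions of positive integers: their values at 0 are  *)
(* irrelevant.                                                                *)
Definition decreasing_to_0 (f : nat -> R) : Prop :=
  (forall m n, (0 < m <= n)%N -> f n <= f m) /\ f @ \oo --> 0.

Definition discrepancy_function (delta : nat -> R) : Prop :=
  (forall n, (0 < n)%N -> 0 < delta n <= 1) /\ decreasing_to_0 delta.

Definition separation_function (Delta : nat -> R) : Prop :=
  (forall n, (0 < n)%N -> 0 < Delta n) /\ decreasing_to_0 Delta.

Definition separated_by X (Delta : nat -> R) : Prop :=
  forall l x y, x \in X l -> y \in X l -> x != y ->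
    Delta #|` X l| < geodist g x y.

Definition admissible_with X (delta : nat -> R) : Prop :=
  [/\ preadmissible X,
      discrepancy_function delta,
      (forall l, discrepancy (X l) < delta #|` X l|) &
      exists2 Delta, separation_function Delta & separated_by X Delta].

Definition well_separated X : Prop :=
  exists2 gamma : R, 0 < gamma &
    separated_by X (fun n => gamma * n%:R `^ (- d%:R^-1)).

(* The value at 0 is irrelevant: the discrete energy omits the diagonal, and  *)
(* the diagonal is a null set for the continuous energy when 0 < d.           *)
Definition riesz (s : R) (r : R) : R := r `^ (- s).

Definition discrete_energy Y (u : R -> R) : R :=
  (#|` Y|%:R ^+ 2)^-1 *
    \sum_(x <- Y) \sum_(y <- Y | y != x) u (geodist g x y).

Definition continuous_energy (u : R -> R) : \bar R :=
  (\int[sigma]_x \int[sigma]_y (u (geodist g x y))%:E)%E.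

End codes.

(* Main.v *)
Require Import Defs.
From HB Require Import structures.
From mathcomp Require Import all_boot all_order all_algebra finmap.
From mathcomp Require Import all_classical all_reals all_analysis.
From mathcomp Require Import measurable_realfun ring lra.
Import Order.TTheory GRing.Theory Num.Theory.
Import numFieldNormedType.Exports.
Local Open Scope classical_set_scope.
Local Open Scope ring_scope.

(** The proof separates the geometry of the manifold from the estimate of the
    energy.

    The estimate holds for a probability [P] and a distance [rho] such that the
    mass of a ball of radius [r] is at most [C * r `^ a] and, for small [r], at
    least [c * r `^ a]. Replace [r `^ (- s)] by its truncation
    [trunc s e r = (max r e) `^ (- s)], whose values lie between 0 and
    [e `^ (- s)].
    - Far field. The superlevel sets of [trunc s e (rho x -)] are balls about
      [x], so the layer-cake formula bounds the difference between its average
      over the code and its integral by [e `^ (- s)] times the discrepancy [D]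
      (mean_trunc_le). Applying this in one variable and then, by symmetry of
      the distance, in the other one compares the truncated energies
      (trunc_energy_le). The layer-cake formula is discretized, which only
      requires finite sums.
    - Near field, continuous. Truncation changes only the pairs at distance less
      than [e]; summing over the dyadic shells [e / 2 ^ (k + 1) <= r < e / 2 ^ k]
      with the upper bound on the mass of balls gives an error of order
      [e `^ (a - s)], because [s < a] makes the series geometric
      (riesz_energy_bounds). The same bounds show that the energy double
      integral is finite.
    - Near field, discrete. If the [N] points are separated by a multiple of
      [N `^ (- a^-1)], the balls of half that radius about them are disjoint and
      of mass at least a multiple of [1 / N]; hence the proportion of code
      points at distance less than [t] from one of them is at most a multiple of
      [t `^ a] (packing), and the dyadic sum applies again (code_energy_le).
      The diagonal, which the truncated energy contains, contributes at most
      [e `^ (- s) / N], and [1 / N <= D] because a ball shrinking to a code point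
      has mass tending to 0 but always contains that point (size_inv_le).

    With [e = D `^ a^-1] all the errors are of order [D `^ (1 - s / a)]
    (code_energy_error). For [a = d] this implies the stated rate, because
    [D < delta N <= 1] and the denominator [d + 2 - s / d] of the exponent is at
    least 1.

    The geometry must supply the distance and the masses of balls. Around each
    point, the continuity and the positivity of the metric give a coordinate
    ball on which the Riemannian norm is comparable to the sup norm and the
    volume density is bounded above and below (comparison_ball_exists).
    Coordinate segments then bound the geodesic distance from above
    (segment_curve). Conversely a curve too short to leave the coordinate ball
    is at least as long as a multiple of the coordinate distance of its ends; it
    cannot leave the ball because at the first exit time it would be in a
    smaller closed coordinate ball (curve_confined, which uses that the manifold
    is Hausdorff). So small geodesic balls lie between coordinate balls of
    proportional radii, whose volumes are known up to constants
    (volume_geoball_near), and compactness makes the constants uniform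
    (volume_geoball). Connectedness makes all distances finite infima
    (joinable_all), hence symmetric and satisfying the triangle inequality. *)

Set Implicit Arguments.
Unset Strict Implicit.
Unset Printing Implicit Defensive.

(** * The truncated Riesz potential function *)

Section truncated_potential.
Context {R : realType}.
Implicit Types s a e r t x y : R.

Lemma powRN_lt s x y : 0 < s -> 0 < x -> x < y -> y `^ (- s) < x `^ (- s).
Proof.
move=> s0 x0 xy; have y0 := lt_trans x0 xy.
by rewrite !powRN ltf_pV2 ?posrE ?powR_gt0// gt0_ltr_powR ?nnegrE ?ltW.
Qed.

Lemma powRN_le s x y : 0 < s -> 0 < x -> x <= y -> y `^ (- s) <= x `^ (- s).
Proof.
by move=> s0 x0; rewrite le_eqVlt => /predU1P[->//|/(powRN_lt s0 x0)/ltW].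
Qed.

Lemma powRN_cancel s t : 0 < s -> 0 < t -> (t `^ (- s^-1)) `^ (- s) = t.
Proof.
move=> s0 t0; rewrite -powRrM mulrNN mulVf ?lt0r_neq0// powRr1 ?ltW//.
Qed.

Lemma powRN_gt s t x : 0 < s -> 0 < t -> 0 < x ->
  (t < x `^ (- s)) = (x < t `^ (- s^-1)).
Proof.
move=> s0 t0 x0; have y0 : 0 < t `^ (- s^-1) by exact: powR_gt0.
rewrite -{1}(powRN_cancel s0 t0); apply/idP/idP => [|/(powRN_lt s0 x0)//].
by apply: contraTT; rewrite -!leNgt => /(powRN_le s0 y0).
Qed.

Lemma powR_small (K b eta : R) : 0 <= K -> 0 < b -> 0 < eta ->
  exists2 r, 0 < r & K * r `^ b <= eta.
Proof.
move=> K0 b0 eta0; have K1 : 0 < K + 1 by rewrite ltr_wpDl.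
exists ((eta / (K + 1)) `^ b^-1); first by rewrite powR_gt0// divr_gt0.
rewrite -powRrM mulVf ?lt0r_neq0// powRr1 ?divr_ge0 ?(ltW eta0) ?(ltW K1)//.
by rewrite mulrA ler_pdivrMr// [leRHS]mulrC ler_pM2r// lerDl.
Qed.

Definition trunc s e r := Num.max r e `^ (- s).

Lemma trunc_ge0 s e r : 0 <= trunc s e r. Proof. exact: powR_ge0. Qed.

Lemma trunc_le s e r : 0 < s -> 0 < e -> trunc s e r <= e `^ (- s).
Proof. by move=> s0 e0; rewrite powRN_le// le_max lexx orbT. Qed.

Lemma trunc_le_powR s e r : 0 < s -> 0 < r -> trunc s e r <= r `^ (- s).
Proof. by move=> s0 r0; rewrite powRN_le// le_max lexx. Qed.

Lemma trunc_far s e r : e <= r -> trunc s e r = r `^ (- s).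
Proof. by move=> er; rewrite /trunc max_l. Qed.

(** Superlevel sets of the truncated potential of the distance to a point are
    open balls, the only sets on which the discrepancy gives information. *)
Lemma trunc_gt s e t r : 0 < s -> 0 < e -> 0 < t < e `^ (- s) ->
  (t < trunc s e r) = (r < t `^ (- s^-1)).
Proof.
move=> s0 e0 /andP[t0 te].
rewrite powRN_gt// ?lt_max ?e0 ?orbT// gt_max.
by rewrite -[X in _ && X]powRN_gt// te andbT.
Qed.

(** Halving the truncation radius [K] times only affects pairs at distance less
    than [e], and the pairs in each dyadic shell are counted by the balls. *)
Lemma trunc_dyadic s e r K : 0 < s -> 0 < e ->
  trunc s (e / 2 ^+ K) r <= trunc s e r +
    \sum_(k < K) (e / 2 ^+ k.+1) `^ (- s) * (r < e / 2 ^+ k)%R%:R.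
Proof.
move=> s0 e0; elim: K => [|K IH]; first by rewrite expr0 divr1 big_ord0 addr0.
rewrite big_ord_recr/= addrA; apply: (le_trans _ (lerD IH (lexx _))).
have ek0 k : 0 < e / 2 ^+ k by rewrite divr_gt0// exprn_gt0.
have [rK|Kr] := ltP r (e / 2 ^+ K).
  by rewrite mulr1 -[leLHS]add0r lerD ?trunc_ge0// trunc_le.
rewrite mulr0 addr0 trunc_far; first by rewrite trunc_far.
apply: le_trans Kr; rewrite ler_pM2l// lef_pV2 ?posrE ?exprn_gt0//.
by rewrite exprS ler_peMl ?exprn_ge0// ler1n.
Qed.

Lemma geometric_le (q : R) n : 0 <= q < 1 -> \sum_(k < n) q ^+ k <= (1 - q)^-1.
Proof.
move=> /andP[q0 q1]; rewrite -[leRHS]mul1r ler_pdivlMr ?subr_gt0//.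
by rewrite mulrC -opprB mulNr -subrX1 opprB gerBl exprn_ge0.
Qed.

Lemma dyadic_ratio s a : s < a ->  0 <= (2 : R) `^ (s - a) < 1.
Proof.
move=> sa; rewrite powR_ge0/= -opprB powRN invf_lt1 ?powR_gt0//.
have as0 : 0 < a - s by rewrite subr_gt0.
have := @gt0_ltr_powR R _ as0 1 2.
by rewrite powR1 ltr1n; apply; rewrite ?nnegrE.
Qed.

(** If balls of radius [r] have mass at most [A * r `^ a], the potential of the
    ball of radius [e] is at most this constant times [e `^ (a - s)]: it sums
    the geometric series of the masses of the dyadic shells. *)
Definition near_const s a A : R := A * 2 `^ s / (1 - 2 `^ (s - a)).

Lemma near_const_ge0 s a A : s < a -> 0 <= A -> 0 <= near_const s a A.
Proof.
move=> sa A0; rewrite divr_ge0 ?mulr_ge0 ?powR_ge0// subr_ge0.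
by rewrite ltW//; case/andP: (dyadic_ratio sa).
Qed.

Lemma dyadic_sum_le s a e A K : 0 < s < a -> 0 < e -> 0 <= A ->
  \sum_(k < K) (e / 2 ^+ k.+1) `^ (- s) * (A * (e / 2 ^+ k) `^ a) <=
  near_const s a A * e `^ (a - s).
Proof.
move=> /andP[s0 sa] e0 A0; set q := 2 `^ (s - a).
have q01 : 0 <= q < 1 by exact: dyadic_ratio.
rewrite (eq_bigr (fun k : 'I_K => A * 2 `^ s * e `^ (a - s) * q ^+ k)).
  rewrite -mulr_sumr /near_const -/q [leRHS]mulrAC; apply: ler_wpM2l.
    by rewrite !mulr_ge0 ?powR_ge0.
  exact: geometric_le.
move=> k _; have p0 n : 0 < 2 ^+ n :> R by rewrite exprn_gt0.
have ek0 : 0 < e / 2 ^+ k by rewrite divr_gt0.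
have -> : e / 2 ^+ k.+1 = e / 2 ^+ k * 2^-1 by rewrite exprS invfM mulrA mulrAC.
rewrite powRM ?invr_ge0 ?(ltW ek0)// -(powR_inv1 (ler0n _ 2)) -powRrM mulrNN mul1r.
have -> (x y z w : R) : x * y * (z * w) = z * y * (x * w) by ring.
rewrite -powRD; last by rewrite (lt0r_neq0 ek0) implybT.
rewrite -[RHS]mulrA; congr (_ * _).
rewrite addrC powRM ?invr_ge0 ?ltW//; congr (_ * _).
rewrite -(powR_mulrn _ (ler0n _ 2)) -(powR_mulrn _ (powR_ge0 _ _)).
by rewrite -powRN -!powRrM; congr (_ `^ _); lra.
Qed.

(** A nonnegative number is recovered from its superlevel sets, up to the
    mesh [h] of a discretized layer-cake formula. *)
Lemma layer_bounds h n x : 0 <= h -> 0 <= x <= n.+1%:R * h ->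
  \sum_(k < n) h * (k.+1%:R * h < x)%R%:R <= x <=
  \sum_(k < n) h * (k.+1%:R * h < x)%R%:R + h.
Proof.
move=> h0; elim: n => [|n IH] /andP[x0 xn]; first by rewrite big_ord0 x0 add0r -[h]mul1r.
rewrite big_ord_recr/=; have [xn1|] := ltP (n.+1%:R * h) x; last first.
  by move=> xn1; rewrite mulr0 addr0 IH// x0.
rewrite (eq_bigr (fun=> h)); last first.
  move=> k _; rewrite (le_lt_trans _ xn1) ?mulr1// ler_wpM2r// ler_nat.
  by rewrite ltnS ltnW.
rewrite sumr_const card_ord mulr1 -[h *+ n]mulr_natl.
by move: xn1 xn; rewrite -!natr1 => xn1 xn; lra.
Qed.

End truncated_potential.

(** * Averages over a code and integrals *)

Section bounded_functions.
Context {R : realType} {disp} {T : measurableType disp} (P : probability T R).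
Implicit Types (f g : T -> R) (Y : seq T).

Lemma bounded_integrable f B : measurable_fun setT f ->
  (forall x, `|f x| <= B) -> P.-integrable setT (EFin \o f).
Proof.
move=> mf fB; apply: measurable_bounded_integrable => //.
  by rewrite (le_lt_trans (probability_le1 P measurableT)) ?ltry.
by exists B; split; [exact: num_real|move=> z /ltW Bz x _; exact: le_trans Bz].
Qed.

Lemma Rintegral_sum (I : Type) (r : seq I) (F : I -> T -> R) :
  (forall k, P.-integrable setT (EFin \o F k)) ->
  \int[P]_x (\sum_(k <- r) F k x) = \sum_(k <- r) \int[P]_x F k x.
Proof.
move=> intF; rewrite /Rintegral.
under eq_integral do rewrite -sumEFin.
rewrite integral_sum// sum_fine// => k _.
by apply: integrable_fin_num => //; exact: intF.
Qed.

Lemma Rintegral_le f g (B : R) : measurable_fun setT f -> measurable_fun setT g ->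
  (forall x, `|f x| <= B) -> (forall x, `|g x| <= B) -> (forall x, f x <= g x) ->
  \int[P]_x f x <= \int[P]_x g x.
Proof.
move=> mf mg fB gB fg.
by apply: le_Rintegral => //; [exact: bounded_integrable fB|exact: bounded_integrable gB].
Qed.

Lemma Rintegral_prob_cst (c : R) : \int[P]_x c = c.
Proof. by rewrite Rintegral_cst//= probability_setT mulr1. Qed.

Lemma measurable_level f t : measurable_fun setT f ->
  measurable [set x | t < f x].
Proof.
move=> mf; rewrite -[X in measurable X]setTI.
rewrite (_ : [set x | _] = f @^-1` `]t, +oo[%classic); first exact: mf.
by apply/seteqP; split => x /=; rewrite in_itv/= andbT.
Qed.

Lemma Rintegral_level f t : measurable_fun setT f ->
  \int[P]_x (t < f x)%R%:R = fine (P [set x | t < f x]).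
Proof.
move=> mf; have mA := measurable_level t mf.
rewrite /Rintegral -[in RHS](setIT [set x | _]) -integral_indic//.
by congr fine; apply: eq_integral => x _; rewrite indicE mem_setE.
Qed.

Lemma measurable_fun_level f t : measurable_fun setT f ->
  measurable_fun setT (fun x => (t < f x)%R%:R : R).
Proof.
move=> mf; rewrite (_ : (fun x => _) = \1_[set x | t < f x]).
  exact/measurable_indic/measurable_level.
by apply/funext => x; rewrite indicE mem_setE.
Qed.

Definition mean Y f : R := (\sum_(y <- Y) f y) / (size Y)%:R.

Lemma le_mean Y f g : {in Y, forall y, f y <= g y} -> mean Y f <= mean Y g.
Proof.
move=> fg; rewrite /mean ler_wpM2r ?invr_ge0// big_seq [leRHS]big_seq.
exact: ler_sum.
Qed.

Lemma meanD Y f g : mean Y (fun y => f y + g y) = mean Y f + mean Y g.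
Proof. by rewrite /mean big_split/= mulrDl. Qed.

Lemma meanZ Y c f : mean Y (fun y => c * f y) = c * mean Y f.
Proof. by rewrite /mean -mulr_sumr mulrA. Qed.

Lemma mean_cst Y c : (0 < size Y)%N -> mean Y (fun=> c) = c.
Proof.
move=> Y0; rewrite /mean big_const_seq count_predT iter_addr_0 -[c *+ _]mulr_natr mulfK//.
by rewrite pnatr_eq0 -lt0n.
Qed.

Lemma mean_sum n Y (F : 'I_n -> T -> R) :
  mean Y (fun y => \sum_(k < n) F k y) = \sum_(k < n) mean Y (F k).
Proof. by rewrite /mean exchange_big/= mulr_suml. Qed.

(** By the layer-cake formula, an average over the code and an integral differ
    by at most the integral over the levels of the discrepancy of the
    superlevel sets. *)
Lemma mean_Rintegral_le Y f (B D : R) : (0 < size Y)%N -> 0 < B -> 0 <= D ->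
  measurable_fun setT f -> (forall x, 0 <= f x <= B) ->
  (forall t : R, 0 < t < B ->
    `|mean Y (fun y => (t < f y)%R%:R) - fine (P [set x | t < f x])| <= D) ->
  `|mean Y f - \int[P]_x f x| <= B * D.
Proof.
move=> Y0 B0 D0 mf fB dD; apply/ler_addgt0Pr => e e0.
have [n ne] : exists n, B / n.+1%:R <= e.
  exists (Num.truncn (B / e)).
  rewrite ler_pdivrMr// mulrC -ler_pdivrMr// ltW//.
  by rewrite truncnS_gt// divr_ge0// ltW.
set h := B / n.+1%:R in ne.
have h0 : 0 < h by rewrite divr_gt0.
have nh : n.+1%:R * h = B by rewrite mulrC divfK.
clearbody h.
pose S x := \sum_(k < n) h * (k.+1%:R * h < f x)%R%:R.
have Sf x : S x <= f x <= S x + h.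
  by apply: layer_bounds; [exact: ltW|rewrite nh].
have mS : measurable_fun setT S.
  apply: measurable_sum => k; apply: measurable_funM => //.
  exact: measurable_fun_level.
have intS : \int[P]_x S x = \sum_(k < n) h * fine (P [set x | k.+1%:R * h < f x]).
  rewrite Rintegral_sum; last first.
    move=> k; apply: (@bounded_integrable _ h) => [|x].
      by apply: measurable_funM => //; exact: measurable_fun_level.
    rewrite ger0_norm ?mulr_ge0 ?(ltW h0)//.
    by rewrite ler_piMr ?(ltW h0) ?(ltW B0)// lern1 leq_b1.
  apply: eq_bigr => k _; rewrite RintegralZl// ?Rintegral_level//.
  apply: (@bounded_integrable _ 1) => [|x]; first exact: measurable_fun_level.
  by rewrite ger0_norm// lern1 leq_b1.
have meanS : mean Y S = \sum_(k < n) h * mean Y (fun y => (k.+1%:R * h < f y)%R%:R).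
  by rewrite mean_sum; apply: eq_bigr => k _; rewrite meanZ.
have dS : `|mean Y S - \int[P]_x S x| <= B * D.
  rewrite intS meanS -sumrB (le_trans (ler_norm_sum _ _ _))//.
  apply: (@le_trans _ _ (\sum_(k < n) h * D)).
    apply: ler_sum => k _; rewrite -mulrBr normrM gtr0_norm// ler_pM2l//.
    apply: dD; rewrite mulr_gt0//= -nh ltr_pM2r// ltr_nat ltnS.
    exact: ltn_ord.
  rewrite sumr_const card_ord -mulrnAl ler_wpM2r// -nh -mulr_natl.
  by rewrite ler_pM2r// ler_nat.
have mean1 : mean Y S <= mean Y f by apply: le_mean => y _; case/andP: (Sf y).
have mean2 : mean Y f <= mean Y S + h.
  rewrite -[X in _ + X](mean_cst _ Y0) -meanD.
  by apply: le_mean => y _; case/andP: (Sf y).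
have S0 x : 0 <= S x by apply: sumr_ge0 => k _; rewrite mulr_ge0// ltW.
have bf x : `|f x| <= B + h.
  case/andP: (fB x) => f0 fle; rewrite ger0_norm// (le_trans fle)//.
  by rewrite lerDl ltW.
have bS x : `|S x| <= B + h.
  rewrite ger0_norm//; case/andP: (Sf x) => + _; move/le_trans; apply.
  exact: le_trans (ler_norm _) (bf x).
have bSh x : `|S x + h| <= B + h.
  rewrite ger0_norm ?addr_ge0 ?(ltW h0)// lerD2r.
  by case/andP: (Sf x) => + _; move/le_trans; apply; case/andP: (fB x).
have int1 : \int[P]_x S x <= \int[P]_x f x.
  by apply: (Rintegral_le mS mf bS bf) => x; case/andP: (Sf x).
have int2 : \int[P]_x f x <= \int[P]_x S x + h.
  rewrite -[X in _ <= _ + X]Rintegral_prob_cst -RintegralD//; last 2 first.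
  - exact: bounded_integrable bS.
  - exact: (@bounded_integrable (fun=> h) `|h|).
  apply: (Rintegral_le mf _ bf bSh); first exact: measurable_funD.
  by move=> x; case/andP: (Sf x).
move: dS; rewrite ler_distl => /andP[d1 d2].
rewrite ler_distl; apply/andP; split; lra.
Qed.

Lemma mean_dist_le Y f g (B : R) : (0 < size Y)%N ->
  {in Y, forall y, `|f y - g y| <= B} -> `|mean Y f - mean Y g| <= B.
Proof.
move=> Y0 fg; rewrite ler_distl; apply/andP; split.
  rewrite lerBlDr -[X in _ + X](mean_cst _ Y0) -meanD; apply: le_mean => y yY.
  by have := fg y yY; rewrite ler_distl lerBlDr => /andP[].
rewrite -[X in _ + X](mean_cst _ Y0) -meanD; apply: le_mean => y yY.
by have := fg y yY; rewrite ler_distl => /andP[].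
Qed.

Lemma Rintegral_dist_le f g (B M : R) :
  measurable_fun setT f -> measurable_fun setT g ->
  (forall x, `|f x| <= M) -> (forall x, `|g x| <= M) ->
  (forall x, `|f x - g x| <= B) -> `|\int[P]_x f x - \int[P]_x g x| <= B.
Proof.
move=> mf mg fM gM fg.
have intf := bounded_integrable mf fM; have intg := bounded_integrable mg gM.
rewrite -RintegralB// -[leRHS]Rintegral_prob_cst.
have mfg : measurable_fun setT (fun x => f x - g x) by exact: measurable_funB.
apply: le_trans (le_normr_Rintegral measurableT _) _.
  exact: bounded_integrable fg.
apply: (@Rintegral_le _ _ B) => // [|x|x].
- exact: measurableT_comp.
- by rewrite normr_id.
- by rewrite ger0_norm// (le_trans _ (fg x)).
Qed.

Lemma sum_disjoint_le (Z : seq T) (B : T -> set T) (A : set T) :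
  uniq Z -> measurable A -> (forall z, measurable (B z)) ->
  {in Z, forall z, B z `<=` A} ->
  {in Z &, forall y z, y != z -> B y `&` B z = set0} ->
  \sum_(z <- Z) fine (P (B z)) <= fine (P A).
Proof.
elim: Z A => [|z Z IH] A /=; first by rewrite big_nil fine_ge0.
move=> /andP[zZ uZ] mA mB BA dB; rewrite big_cons.
have PfinT (S : set T) : measurable S -> P S \is a fin_num.
  by move=> mS; exact: fin_num_measure.
have ABz : A `&` B z = B z by apply: setIidr; apply: BA; rewrite inE eqxx.
rewrite [in leRHS](measureDI P mA (mB z)) ABz.
rewrite fineD; [|exact/PfinT/measurableD|exact/PfinT].
rewrite [leLHS]addrC lerD2r; apply: IH => //.
- exact: measurableD.
- move=> y yZ x Byx; split; first by apply: BA Byx; rewrite inE yZ orbT.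
  move=> Bzx; have : (B y `&` B z) x by [].
  rewrite dB ?inE ?eqxx ?yZ ?orbT//.
  by apply: contraNneq zZ => <-.
- by move=> y1 y2 h1 h2; apply: dB; rewrite inE ?h1 ?h2 orbT.
Qed.

End bounded_functions.

(** * Riesz energies on a metric probability space *)

Section metric_probability.
Context {R : realType} {disp} {T : measurableType disp} (P : probability T R).
(* That open sets for [rho] are measurable will give the measurability of the
   potentials, from their semicontinuity. *)
Context (rho : T -> T -> R).
Context (rho_ge0 : forall x y, 0 <= rho x y) (rho_refl : forall x, rho x x = 0)
  (rho_sym : forall x y, rho x y = rho y x)
  (rho_triangle : forall x y z, rho x z <= rho x y + rho y z)
  (rho_open_measurable : forall A : set T,
    (forall x, A x -> exists2 r : R, 0 < r & forall y, rho x y < r -> A y) ->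
    measurable A).
Context (s a C : R) (s0a : 0 < s < a) (C0 : 0 <= C)
  (P_ball_le : forall x (r : R), 0 < r ->
    fine (P [set y | rho x y < r]) <= C * r `^ a).

Implicit Types (x y : T) (e r t : R).

Let s0 : 0 < s. Proof. by case/andP: s0a. Qed.

Lemma measurable_dist_ball x r : measurable [set y | rho x y < r].
Proof.
apply: rho_open_measurable => y /= yr; exists (r - rho x y).
  by rewrite subr_gt0.
by move=> z; rewrite ltrBrDl; exact/le_lt_trans/rho_triangle.
Qed.

Lemma measurable_dist x : measurable_fun setT (rho x).
Proof.
apply: (measurability (@RGenInftyO.G R)); first exact: RGenInftyO.measurableE.
move=> _ [_ [r ->] <-]; rewrite setTI.
rewrite (_ : _ @^-1` _ = [set y | rho x y < r]); first exact: measurable_dist_ball.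
by apply/seteqP; split => y /=; rewrite in_itv.
Qed.

Lemma measurable_trunc e x : measurable_fun setT (fun y => trunc s e (rho x y)).
Proof.
apply: (measurableT_comp (measurable_powR _)).
by apply: measurable_maxr => //; exact: measurable_dist.
Qed.

Lemma trunc_normr_le e x y : 0 < e -> `|trunc s e (rho x y)| <= e `^ (- s).
Proof. by move=> e0; rewrite ger0_norm ?trunc_ge0// trunc_le. Qed.

Definition potential e x : R := \int[P]_y trunc s e (rho x y).

Lemma potentialE e x : potential e x = \int[P]_y trunc s e (rho x y).
Proof. by []. Qed.

Local Opaque potential.

Lemma potential_le e x : 0 < e -> 0 <= potential e x <= e `^ (- s).
Proof.
move=> e0; rewrite potentialE Rintegral_ge0/=; last by move=> *; exact: trunc_ge0.
rewrite -[leRHS](Rintegral_prob_cst P).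
apply: (@Rintegral_le _ _ _ _ _ _ (e `^ (- s))) => [|//|y|y|y].
- exact: measurable_trunc.
- exact: trunc_normr_le.
- by rewrite ger0_norm ?powR_ge0.
- exact: trunc_le.
Qed.

(** Moving the base point by [h] multiplies the truncated distances
    [max (rho x y) e] by at most [1 + h / e]; this makes the truncated potential
    lower semicontinuous. *)
Lemma measurable_potential e : 0 < e -> measurable_fun setT (potential e).
Proof.
move=> e0; apply: (measurability (@RGenOInfty.G R)).
  exact: RGenOInfty.measurableE.
move=> _ [_ [t ->] <-]; rewrite setTI.
have -> : potential e @^-1` `]t, +oo[%classic = [set x | t < potential e x].
  by apply/seteqP; split => x; rewrite /preimage/= in_itv andbT.
apply: rho_open_measurable => x; rewrite /mkset => tx.
have [t0|t0] := ltP t 0.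
  exists 1 => [|y _]; first exact: ltr01.
  apply: (lt_le_trans t0).
  by case/andP: (potential_le y e0).
have p0 : 0 < potential e x := le_lt_trans t0 tx.
pose c := (t + potential e x) / (2 * potential e x).
have c0 : 0 < c by rewrite divr_gt0 ?mulr_gt0 ?ltr_wpDl.
have c1 : c < 1 by rewrite ltr_pdivrMr ?mulr_gt0// mul1r; lra.
have cp : t < c * potential e x.
  have -> : c * potential e x = (t + potential e x) / 2.
    by rewrite /c invfM; field; exact: lt0r_neq0.
  lra.
pose w := c `^ (- s^-1).
have w1 : 1 < w.
  have s0V : 0 < s^-1 by rewrite invr_gt0.
  by have := powRN_lt s0V c0 c1; rewrite powR1.
have ws : w `^ (- s) = c by exact: powRN_cancel.
exists (e * (w - 1)); first by rewrite mulr_gt0// subr_gt0.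
move=> y yx; apply: (lt_le_trans cp).
rewrite !potentialE -RintegralZl; first last.
- by apply: (bounded_integrable P (measurable_trunc e x)) => z; exact: trunc_normr_le.
- exact: measurableT.
apply: (@Rintegral_le _ _ _ _ _ _ (e `^ (- s))) => [||z|z|z].
- by apply: measurable_funM => //; exact: measurable_trunc.
- exact: measurable_trunc.
- rewrite ger0_norm; last by rewrite mulr_ge0 ?trunc_ge0// ltW.
  apply: (le_trans _ (trunc_le (rho x z) s0 e0)).
  by rewrite ler_piMl ?trunc_ge0// ltW.
- exact: trunc_normr_le.
rewrite /trunc -ws -powRM; first last.
- by rewrite le_max (ltW e0) orbT.
- exact: powR_ge0.
apply: powRN_le => //; first by rewrite lt_max e0 orbT.
rewrite ge_max; apply/andP; split; last first.
  rewrite -[leLHS]mul1r; apply: ler_pM; rewrite ?ler01 ?(ltW e0) ?(ltW w1)//.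
  by rewrite le_max lexx orbT.
have m0 : e <= Num.max (rho x z) e by rewrite le_max lexx orbT.
have m1 : rho x z <= Num.max (rho x z) e by rewrite le_max lexx.
have := rho_triangle y x z; rewrite [rho y x]rho_sym => h.
have : e * (w - 1) <= Num.max (rho x z) e * (w - 1) by rewrite ler_wpM2r// subr_ge0 ltW.
rewrite mulrBr mulr1 => h2; rewrite mulrC; lra.
Qed.

Definition near_bound e : R := near_const s a C * e `^ (a - s).

(** The upper bound does not depend on [K]: this is where [s < a] is used, and
    what makes the untruncated potential finite. *)
Lemma potential_dyadic e K x : 0 < e ->
  potential e x <= potential (e / 2 ^+ K) x <= potential e x + near_bound e.
Proof.
move=> e0; have ek0 k : 0 < e / 2 ^+ k by rewrite divr_gt0// exprn_gt0.
have eK : e / 2 ^+ K <= e.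
  by rewrite ler_pdivrMr ?exprn_gt0// ler_peMr ?(ltW e0)// exprn_ege1// ler1n.
rewrite !potentialE; apply/andP; split.
  apply: (@Rintegral_le _ _ _ _ _ _ ((e / 2 ^+ K) `^ (- s))) => [||y|y|y].
  - exact: measurable_trunc.
  - exact: measurable_trunc.
  - exact/(le_trans (trunc_normr_le _ _ _))/powRN_le.
  - exact: trunc_normr_le.
  - rewrite powRN_le ?lt_max ?ek0 ?orbT// ge_max le_max lexx/=.
    by rewrite le_max eK orbT.
pose F (k : 'I_K) y := (e / 2 ^+ k.+1) `^ (- s) * (rho x y < e / 2 ^+ k)%R%:R.
have mlt k : measurable_fun setT (fun y => (rho x y < e / 2 ^+ k)%R%:R : R).
  rewrite (_ : (fun y => _) = \1_[set y | rho x y < e / 2 ^+ k]).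
    exact/measurable_indic/measurable_dist_ball.
  by apply/funext => y; rewrite indicE mem_setE.
have mF k : measurable_fun setT (F k) by exact: measurable_funM.
have F0 k y : 0 <= F k y by rewrite mulr_ge0// powR_ge0.
have FB k y : `|F k y| <= (e / 2 ^+ k.+1) `^ (- s).
  by rewrite ger0_norm// ler_piMr ?powR_ge0// lern1 leq_b1.
have intF k : P.-integrable setT (EFin \o F k).
  exact: (bounded_integrable P (mF k) (FB k)).
have intS : P.-integrable setT (EFin \o (fun y => \sum_k F k y)).
  apply: (@bounded_integrable _ _ _ _ _ (\sum_(k < K) (e / 2 ^+ k.+1) `^ (- s))).
    exact: measurable_sum.
  by move=> y; rewrite (le_trans (ler_norm_sum _ _ _))// ler_sum.
have intT d : 0 < d -> P.-integrable setT (EFin \o (fun y => trunc s d (rho x y))).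
  move=> d0; apply: (bounded_integrable P (measurable_trunc d x)) => y.
  exact: trunc_normr_le.
apply: (@le_trans _ _ (\int[P]_y (trunc s e (rho x y) + \sum_(k < K) F k y))).
  apply: le_Rintegral => //; first exact: intT.
    by rewrite (_ : EFin \o _ = (EFin \o (fun y => trunc s e (rho x y))) \+
      (EFin \o (fun y => \sum_k F k y)))//; apply: integrableD => //; exact: intT.
  by move=> y _; exact: trunc_dyadic.
rewrite RintegralD//; last exact: intT.
rewrite lerD2l Rintegral_sum//.
apply: le_trans (dyadic_sum_le K s0a e0 C0); apply: ler_sum => k _.
rewrite RintegralZl//; last first.
  apply: (bounded_integrable (B := 1) P (mlt k)) => y.
  by rewrite ger0_norm// lern1 leq_b1.
rewrite ler_wpM2l ?powR_ge0//; apply: le_trans (P_ball_le x (ek0 k)).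
rewrite /Rintegral -[X in P X]setIT -integral_indic//; last exact: measurable_dist_ball.
by rewrite le_eqVlt; apply/orP; left; apply/eqP; congr fine; apply: eq_integral => y _; rewrite indicE mem_setE.
Qed.

(** As [0 `^ (- s) = 0], the truncated potential function exceeds the Riesz one
    at distance 0, hence only on a null set. *)
Lemma ball_null x : P [set y | rho x y <= 0] = 0%E.
Proof.
have m0 : measurable [set y | rho x y <= 0].
  rewrite (_ : [set y | _] = ~` [set y | 0 < rho x y]).
    exact/measurableC/measurable_level/measurable_dist.
  by apply/seteqP; split => y /=; [rewrite leNgt => /negP|move/negP; rewrite leNgt].
apply/eqP; rewrite eq_le measure_ge0 andbT; apply/lee_addgt0Pr => e e0.
rewrite add0e; have a0 : 0 < a by apply: lt_trans s0 _; case/andP: s0a.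
have [r r0 Cr] := powR_small C0 a0 e0.
apply: (@le_trans _ _ (P [set y | rho x y < r])).
  apply: le_measure; rewrite ?inE//; first exact: measurable_dist_ball.
  by move=> y /= h; exact: le_lt_trans r0.
have fP : P [set y | rho x y < r] \is a fin_num.
  exact/fin_num_measure/measurable_dist_ball.
by rewrite -(fineK fP) lee_fin (le_trans (P_ball_le x r0)).
Qed.

Definition riesz_potential x : \bar R := (\int[P]_y ((rho x y) `^ (- s))%:E)%E.

Lemma measurable_riesz x : measurable_fun setT (fun y => ((rho x y) `^ (- s))%:E).
Proof.
apply/measurable_EFinP; apply: (measurableT_comp (measurable_powR _)).
exact: measurable_dist.
Qed.

(** The singular potential is the increasing limit of its restrictions to the
    complements of the balls of radius [e / 2 ^ k], each of which is below a
    truncated potential. *)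
Lemma riesz_potential_bounds e x : 0 < e ->
  ((potential e x)%:E <= riesz_potential x <= (potential e x + near_bound e)%:E)%E.
Proof.
move=> e0; have ek0 k : 0 < e / 2 ^+ k by rewrite divr_gt0// exprn_gt0.
have intT d : 0 < d ->
    (\int[P]_y (trunc s d (rho x y))%:E = (potential d x)%:E)%E.
  move=> d0; rewrite potentialE /Rintegral fineK//; apply: integrable_fin_num => //.
  apply: (bounded_integrable P (measurable_trunc d x)) => y.
  exact: trunc_normr_le.
apply/andP; split.
  rewrite -intT//; apply: ae_ge0_le_integral => //.
  - by move=> y _; rewrite lee_fin trunc_ge0.
  - exact/measurable_EFinP/measurable_trunc.
  - by move=> y _; rewrite lee_fin powR_ge0.
  - exact: measurable_riesz.
  exists [set y | rho x y <= 0]; split.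
  - rewrite (_ : [set y | _] = ~` [set y | 0 < rho x y]).
      exact/measurableC/measurable_level/measurable_dist.
    by apply/seteqP; split => y /=; [rewrite leNgt => /negP|move/negP; rewrite leNgt].
  - exact: ball_null.
  - move=> y /= h; rewrite leNgt; apply/negP => y0; apply: h => _.
    by rewrite lee_fin trunc_le_powR.
pose g k y : \bar R := ((e / 2 ^+ k <= rho x y)%R%:R * (rho x y) `^ (- s))%:E.
have mg k : measurable_fun setT (g k).
  apply/measurable_EFinP; apply: measurable_funM; last exact/measurable_EFinP/measurable_riesz.
  rewrite (_ : (fun y => _) = \1_(~` [set y | rho x y < e / 2 ^+ k])).
    exact/measurable_indic/measurableC/measurable_dist_ball.
  apply/funext => y; rewrite indicE leNgt; congr (nat_of_bool _)%:R.
  by apply/idP/idP; rewrite in_setE/= => /negP.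
have g0 k y : (0 <= g k y)%E by rewrite lee_fin mulr_ge0// powR_ge0.
have gnd y : {homo g^~ y : n m / (n <= m)%N >-> (n <= m)%E}.
  move=> n m nm; rewrite lee_fin ler_wpM2r ?powR_ge0// ler_nat.
  have [h|//] := boolP (e / 2 ^+ n <= rho x y).
  rewrite (le_trans _ h)// ler_pM2l// lef_pV2 ?posrE ?exprn_gt0//.
  by rewrite ler_eXn2l// ltr1n.
have glim y : limn (g^~ y) = ((rho x y) `^ (- s))%:E.
  apply/cvg_lim => //; have [h|h] := ltP 0 (rho x y); last first.
    have -> : rho x y = 0 by apply/eqP; rewrite eq_le h rho_ge0.
    rewrite powR0 ?oppr_eq0 ?lt0r_neq0//.
    rewrite (_ : g^~ y = cst 0%E); first exact: cvg_cst.
    apply/funext => k; rewrite /g (_ : (_ <= _) = false) ?mul0r//.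
    by apply/negbTE; rewrite -ltNge; exact: le_lt_trans h _.
  apply: cvg_near_cst; exists (Num.truncn (e / rho x y)) => // n /= hn.
  rewrite /g (_ : (_ <= _) = true) ?mul1r//.
  rewrite ler_pdivrMr ?exprn_gt0// mulrC -ler_pdivrMr// ltW//.
  apply: lt_le_trans (truncnS_gt _) _.
  rewrite -natrX ler_nat (leq_ltn_trans hn)//.
  exact: ltn_expl.
rewrite /riesz_potential.
under eq_integral => y _ do rewrite -glim.
have cvg_int := cvg_monotone_convergence (mu := P) measurableT mg (fun k y _ => g0 k y) (fun y _ => gnd y).
rewrite -(cvg_lim _ cvg_int)//; apply: lime_le; first exact: cvgP cvg_int.
apply: nearW => k; apply: (@le_trans _ _ (potential (e / 2 ^+ k) x)%:E); last first.
  by rewrite lee_fin; case/andP: (potential_dyadic k x e0).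
rewrite -intT//; apply: ge0_le_integral => //.
- exact/measurable_EFinP/measurable_trunc.
- move=> y _; rewrite lee_fin.
  have [h|h] := boolP (e / 2 ^+ k <= rho x y); last by rewrite mul0r trunc_ge0.
  by rewrite mul1r trunc_far.
Qed.

Lemma near_bound_small eta : 0 < eta -> exists2 e : R, 0 < e & near_bound e <= eta.
Proof.
case/andP: (s0a) => _ sa; apply: powR_small; last by rewrite subr_gt0.
exact: near_const_ge0.
Qed.

(** The singular potential is a uniform limit of truncated ones. *)
Lemma measurable_riesz_potential : measurable_fun setT riesz_potential.
Proof.
have /choice[e he] (n : nat) : exists e : R, 0 < e /\ near_bound e <= n.+1%:R^-1.
  by have [|e e0 he] := @near_bound_small n.+1%:R^-1; [rewrite invr_gt0|exists e].
apply: (@emeasurable_fun_cvg _ _ _ _ (fun n x => (potential (e n) x)%:E)).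
  by move=> n; apply/measurable_EFinP/measurable_potential; case: (he n).
move=> x _; have /andP[_ h1] := riesz_potential_bounds x (he 0).1.
have /andP[h0 _] := riesz_potential_bounds x (he 0).1.
have fx : riesz_potential x \is a fin_num.
  by rewrite fin_numE; apply/andP; split; apply/eqP => h; rewrite h in h0 h1.
rewrite -(fineK fx); apply: cvg_EFin; first exact: nearW.
apply/cvgrPdist_le => eta eta0.
near=> n; rewrite /= ler_distl; have [e0 en] := he n.
have := riesz_potential_bounds x e0; rewrite -(fineK fx) !lee_fin => /andP[h2 h3].
have hn : n.+1%:R^-1 <= eta by apply/ltW; near: n; exact: (near_infty_natSinv_lt (PosNum eta0)).
rewrite -[fine _%:E]/(fine (riesz_potential x)).
apply/andP; split; first by rewrite (le_trans _ h2)// gerBl ltW.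
by rewrite (le_trans h3)// lerD2l (le_trans en).
Unshelve. all: by end_near. Qed.

Definition riesz_energy : \bar R := (\int[P]_x riesz_potential x)%E.

Lemma riesz_energy_bounds e : 0 < e ->
  ((\int[P]_x potential e x)%:E <= riesz_energy <=
   (\int[P]_x potential e x + near_bound e)%:E)%E.
Proof.
move=> e0; have mp := measurable_potential e0.
have ip : P.-integrable setT (EFin \o potential e).
  apply: (bounded_integrable (B := e `^ (- s)) P mp) => x.
  by case/andP: (potential_le x e0) => h0 h1; rewrite ger0_norm.
have intE : (\int[P]_x (potential e x)%:E = (\int[P]_x potential e x)%:E)%E.
  by rewrite /Rintegral fineK//; exact: integrable_fin_num.
have b0 : 0 <= near_bound e.
  by rewrite mulr_ge0 ?powR_ge0 ?near_const_ge0//; case/andP: s0a.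
apply/andP; split.
  rewrite -intE; apply: ge0_le_integral => //.
  - by move=> x _; rewrite lee_fin; case/andP: (potential_le x e0).
  - exact/measurable_EFinP.
  - exact: measurable_riesz_potential.
  - by move=> x _; case/andP: (riesz_potential_bounds x e0).
rewrite EFinD -intE -[X in (_ + X)%E](_ : (\int[P]_x (near_bound e)%:E = _)%E); last first.
  by rewrite integral_cst//= probability_setT mule1.
rewrite -ge0_integralD//.
- apply: ge0_le_integral => //.
  - by move=> x _; apply: integral_ge0 => y _; rewrite lee_fin powR_ge0.
  - exact: measurable_riesz_potential.
  - by apply: emeasurable_funD => //; exact/measurable_EFinP.
  - by move=> x _; rewrite -EFinD; case/andP: (riesz_potential_bounds x e0).
- by move=> x _; rewrite lee_fin; case/andP: (potential_le x e0).
- exact/measurable_EFinP.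
Qed.

Lemma riesz_energy_fin_num : riesz_energy \is a fin_num.
Proof.
have /andP[h0 h1] := riesz_energy_bounds (ltr01 : 0 < 1 :> R).
by rewrite fin_numE; apply/andP; split; apply/eqP => h; rewrite h in h0 h1.
Qed.

Section code.
Context (c gam : R) (c0 : 0 < c) (gam0 : 0 < gam)
  (P_ball_ge : forall x (r : R), 0 < r <= gam ->
    c * r `^ a <= fine (P [set y | rho x y < r])).
Context (Y : seq T) (D : R) (Y_uniq : uniq Y) (Y_gt0 : (0 < size Y)%N).
Context (Y_separated : forall x y, x \in Y -> y \in Y -> x != y ->
    gam * (size Y)%:R `^ (- a^-1) < rho x y)
  (D_discrepancy : forall y (r : R), 0 < r ->
    `|mean Y (fun z => (rho y z < r)%R%:R) - fine (P [set z | rho y z < r])| <= D).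

Let a0 : 0 < a. Proof. by apply: lt_trans s0 _; case/andP: s0a. Qed.
Let N0 : 0 < (size Y)%:R :> R. Proof. by rewrite ltr0n. Qed.

(** The normalized counting measure of the code, deprived of its point [x],
    satisfies the same bound on the balls about [x] as the measure [P], with
    this constant instead of [C]. *)
Definition packing_const : R := C * 4 `^ a / (c * gam `^ a).

Lemma packing_const_ge0 : 0 <= packing_const.
Proof. by rewrite divr_ge0 ?mulr_ge0 ?powR_ge0// ltW. Qed.

(** Balls whose radius is half the separation distance are disjoint, so the
    number of code points close to [x] is controlled by a volume comparison. *)
Lemma packing x (t : R) : x \in Y -> 0 < t ->
  (\sum_(y <- Y | y != x) (rho x y < t)%R%:R) / (size Y)%:R <=
  packing_const * t `^ a.
Proof.
move=> xY t0; set q := gam * (size Y)%:R `^ (- a^-1).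
have q0 : 0 < q by rewrite mulr_gt0// powR_gt0.
have [tq|qt] := leP t q.
  rewrite big_seq_cond big1 ?mul0r; first exact: mulr_ge0 packing_const_ge0 (powR_ge0 _ _).
  move=> y /andP[yY yx]; rewrite ltNge ltW// (le_lt_trans tq)//.
  by apply: Y_separated; rewrite // eq_sym.
pose Z := [seq y <- Y | (y != x) && (rho x y < t)].
have sumZ : \sum_(y <- Y | y != x) (rho x y < t)%R%:R = (size Z)%:R :> R.
  rewrite -natr_sum; congr _%:R; rewrite size_filter -sum1_count [RHS]big_mkcondr.
  by apply: eq_bigr => y _; case: ifP.
have qgam : q / 2 <= gam.
  rewrite ler_pdivrMr// /q ler_pM2l// (@le_trans _ _ 1)// ?ler1n//.
  by rewrite -[leRHS](powRr0 (size Y)%:R) ler_powR ?ler1n// oppr_le0 invr_ge0 ltW.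
have vol : \sum_(y <- Z) fine (P [set z | rho y z < q / 2]) <=
    fine (P [set z | rho x z < 2 * t]).
  apply: sum_disjoint_le.
  - exact: filter_uniq.
  - exact: measurable_dist_ball.
  - by move=> z; exact: measurable_dist_ball.
  - move=> y; rewrite mem_filter => /andP[/andP[_ xyt] _] z /= yzq.
    by rewrite (le_lt_trans (rho_triangle x y z))//; lra.
  - move=> y z; rewrite !mem_filter => /andP[_ yY] /andP[_ zY] yz.
    apply/seteqP; split => // w /= [yw zw].
    have := Y_separated yY zY yz; rewrite -/q => qyz.
    have := rho_triangle y w z; rewrite [rho w z]rho_sym; lra.
have q2 : 0 < q / 2 <= gam by rewrite qgam divr_gt0.
have volge : (size Z)%:R * (c * (q / 2) `^ a) <= C * (2 * t) `^ a.
  apply: le_trans (P_ball_le x _); last by rewrite mulr_gt0.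
  apply: le_trans vol; rewrite mulr_natl -[size Z]/(size Z) -(count_predT Z).
  rewrite -[in leLHS]iter_addr_0 -big_const_seq.
  by apply: ler_sum => y _; exact: P_ball_ge.
have qa : q `^ a = gam `^ a / (size Y)%:R.
  rewrite powRM ?powR_ge0 ?(ltW gam0)// -powRrM mulNr mulVf ?lt0r_neq0//.
  by rewrite powR_inv1.
have p2 : 0 < 2 `^ a :> R by rewrite powR_gt0.
have pg : 0 < gam `^ a by rewrite powR_gt0.
have h4 : 4 `^ a = 2 `^ a * 2 `^ a :> R by rewrite -powRM//; congr (_ `^ _); ring.
have q2a : (q / 2) `^ a = gam `^ a / (size Y)%:R / 2 `^ a.
  rewrite powRM ?invr_ge0 ?(ltW q0)// qa; congr (_ * _).
  by rewrite -(powR_inv1 (ler0n _ 2)) -powRrM mulN1r powRN.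
rewrite sumZ; move: volge; rewrite q2a powRM ?(ltW t0)// => volge.
rewrite /packing_const h4 [leRHS]mulrAC ler_pdivlMr ?mulr_gt0//.
rewrite [leLHS](_ : _ = ((size Z)%:R * (c * (gam `^ a / (size Y)%:R / 2 `^ a))) * 2 `^ a); last first.
  by field; rewrite !lt0r_neq0.
rewrite [leRHS](_ : _ = (C * (2 `^ a * t `^ a)) * 2 `^ a); last by ring.
by rewrite ler_pM2r.
Qed.

Lemma code_dyadic e K x : x \in Y -> 0 < e ->
  (\sum_(y <- Y | y != x) trunc s (e / 2 ^+ K) (rho x y)) / (size Y)%:R <=
  (\sum_(y <- Y | y != x) trunc s e (rho x y)) / (size Y)%:R +
  near_const s a packing_const * e `^ (a - s).
Proof.
move=> xY e0; have ek0 k : 0 < e / 2 ^+ k by rewrite divr_gt0// exprn_gt0.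
apply: (@le_trans _ _ ((\sum_(y <- Y | y != x) (trunc s e (rho x y) +
    \sum_(k < K) (e / 2 ^+ k.+1) `^ (- s) * (rho x y < e / 2 ^+ k)%R%:R)) / (size Y)%:R)).
  rewrite ler_pM2r ?invr_gt0//; apply: ler_sum => y _.
  exact: trunc_dyadic.
rewrite big_split/= mulrDl lerD2l.
apply: le_trans (dyadic_sum_le K s0a e0 packing_const_ge0).
rewrite exchange_big/= mulr_suml; apply: ler_sum => k _.
rewrite -mulr_sumr -mulrA ler_wpM2l ?powR_ge0//.
exact: packing.
Qed.

Definition code_energy : R := ((size Y)%:R ^+ 2)^-1 *
  \sum_(x <- Y) \sum_(y <- Y | y != x) (rho x y) `^ (- s).

Lemma code_energyE :
  code_energy = mean Y (fun x => (\sum_(y <- Y | y != x) (rho x y) `^ (- s)) / (size Y)%:R).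
Proof. by rewrite /code_energy /mean -mulr_suml mulrC expr2 invfM mulrA. Qed.

(** The diagonal is included: its contribution [e `^ (- s) / N] is of the order
    of the other errors because [1 / N] is at most the discrepancy. *)
Definition trunc_energy e : R := mean Y (fun x => mean Y (fun y => trunc s e (rho x y))).

Lemma mean_split x (F : T -> R) : x \in Y ->
  mean Y F = F x / (size Y)%:R + (\sum_(y <- Y | y != x) F y) / (size Y)%:R.
Proof. by move=> xY; rewrite /mean (bigD1_seq x)//= mulrDl. Qed.

Lemma code_energy_le e : 0 < e ->
  code_energy <= trunc_energy e + near_const s a packing_const * e `^ (a - s).
Proof.
move=> e0; rewrite code_energyE -[X in _ + X](mean_cst _ Y_gt0) -meanD.
apply: le_mean => x xY; rewrite (mean_split _ xY).
pose q := gam * (size Y)%:R `^ (- a^-1).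
have q0 : 0 < q by rewrite mulr_gt0// powR_gt0.
(* A dyadic truncation radius below the separation distance has no effect. *)
pose K := Num.truncn (e / q).
have eK : e / 2 ^+ K.+1 <= q.
  rewrite ler_pdivrMr ?exprn_gt0// mulrC -ler_pdivrMr// ltW//.
  apply: lt_le_trans (truncnS_gt _) _.
  by rewrite -natrX ler_nat ltnW// ltn_expl.
rewrite -addrA ler_wpDl ?divr_ge0 ?trunc_ge0//.
apply: le_trans (code_dyadic K.+1 xY e0).
rewrite ler_pM2r ?invr_gt0// big_seq_cond [leRHS]big_seq_cond.
apply: ler_sum => y /andP[yY yx]; rewrite trunc_far// (le_trans eK)//.
by rewrite ltW// Y_separated// eq_sym.
Qed.

Lemma code_energy_ge e : 0 < e ->
  trunc_energy e <= code_energy + e `^ (- s) / (size Y)%:R.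
Proof.
move=> e0; rewrite code_energyE -[X in _ + X](mean_cst _ Y_gt0) -meanD.
apply: le_mean => x xY; rewrite (mean_split _ xY) addrC.
rewrite lerD ?ler_pM2r ?invr_gt0 ?trunc_le//.
rewrite big_seq_cond [leRHS]big_seq_cond.
apply: ler_sum => y /andP[yY yx]; rewrite trunc_le_powR//.
apply: lt_trans (Y_separated xY yY _); last by rewrite eq_sym.
by rewrite mulr_gt0// powR_gt0.
Qed.

(** A ball shrinking to a code point keeps at least the proportion [1 / N] of
    the code while its mass tends to 0. *)
Lemma size_inv_le : (size Y)%:R^-1 <= D.
Proof.
have [x xY] : exists x, x \in Y.
  by case: Y Y_gt0 => // y Z _; exists y; rewrite inE eqxx.
apply/ler_addgt0Pr => e e0; have [r r0 Cr] := powR_small C0 a0 e0.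
have mge : (size Y)%:R^-1 <= mean Y (fun z => (rho x z < r)%R%:R) :> R.
  rewrite (mean_split _ xY) rho_refl r0 div1r lerDl divr_ge0//.
  by rewrite sumr_ge0.
have Ple : fine (P [set z | rho x z < r]) <= e.
  exact: le_trans (P_ball_le x r0) Cr.
have := D_discrepancy x r0; rewrite ler_distl => /andP[_ h].
by rewrite (le_trans mge)// (le_trans h)// addrC lerD2l.
Qed.

Lemma mean_trunc_le e x : 0 < e ->
  `|mean Y (fun y => trunc s e (rho x y)) - potential e x| <= e `^ (- s) * D.
Proof.
move=> e0; rewrite potentialE; apply: mean_Rintegral_le => //.
- by rewrite powR_gt0.
- by apply: le_trans size_inv_le; rewrite invr_ge0.
- exact: measurable_trunc.
- by move=> y; rewrite trunc_ge0 trunc_le.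
move=> t te; have t0 : 0 < t by case/andP: te.
have r0 : 0 < t `^ (- s^-1) by rewrite powR_gt0.
have := D_discrepancy x r0.
rewrite (_ : [set z | rho x z < _] = [set y | t < trunc s e (rho x y)]); last first.
  by apply/seteqP; split => y /=; rewrite trunc_gt.
by rewrite (_ : (fun z => _) = (fun y => (t < trunc s e (rho x y))%R%:R))//;
  apply/funext => y; rewrite trunc_gt.
Qed.

(** The discrepancy is used twice: at the code points, then, by symmetry of
    the distance, under the integral over all the points. *)
Lemma trunc_energy_le e : 0 < e ->
  `|trunc_energy e - \int[P]_x potential e x| <= 2 * (e `^ (- s) * D).
Proof.
move=> e0; have mp := measurable_potential e0.
have ip : P.-integrable setT (EFin \o potential e).
  apply: (bounded_integrable (B := e `^ (- s)) P mp) => x.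
  by case/andP: (potential_le x e0) => h0 h1; rewrite ger0_norm.
have mt x : measurable_fun setT (fun z => trunc s e (rho z x)).
  rewrite (_ : (fun z => _) = (fun z => trunc s e (rho x z))).
    exact: measurable_trunc.
  by apply/funext => z; rewrite rho_sym.
have it x : P.-integrable setT (EFin \o (fun y => trunc s e (rho y x))).
  apply: (bounded_integrable P (mt x)) => y.
  exact: trunc_normr_le.
have D0 : 0 <= D by apply: le_trans size_inv_le; rewrite invr_ge0.
have mtr : measurable_fun setT (fun z => mean Y (fun y => trunc s e (rho z y))).
  by apply: measurable_funM => //; exact: measurable_sum.
have tB x y := trunc_normr_le x y e0.
have step1 : `|trunc_energy e - mean Y (potential e)| <= e `^ (- s) * D.
  by apply: mean_dist_le => // x _; exact: mean_trunc_le.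
(* By symmetry, averaging the potential of [P] over the code is integrating the
   potential of the code. *)
have swap : mean Y (potential e) = \int[P]_z mean Y (fun y => trunc s e (rho z y)).
  rewrite /mean RintegralZr//; last first.
    apply: (bounded_integrable (B := \sum_(y <- Y) e `^ (- s)) P).
      exact: measurable_sum.
    by move=> z; rewrite (le_trans (ler_norm_sum _ _ _))// ler_sum.
  congr (_ / _); rewrite (Rintegral_sum _ it); apply: eq_bigr => y _.
  by rewrite potentialE; apply: eq_Rintegral => z _; rewrite rho_sym.
have step2 : `|mean Y (potential e) - \int[P]_x potential e x| <= e `^ (- s) * D.
  rewrite swap; apply: (@Rintegral_dist_le _ _ _ P _ _ _ (e `^ (- s)) mtr mp) => x.
  - suff : `|mean Y (fun y => trunc s e (rho x y)) - mean Y (fun=> 0)| <= e `^ (- s).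
      by rewrite (mean_cst 0 Y_gt0) subr0.
    by apply: mean_dist_le => // y _; rewrite subr0.
  - by case/andP: (potential_le x e0) => h0 h1; rewrite ger0_norm.
  - exact: mean_trunc_le.
rewrite -(subrKA (mean Y (potential e))) (le_trans (ler_normD _ _))//.
by rewrite mulr_natl mulr2n lerD.
Qed.

(** Truncating at [D `^ a^-1] balances the near-field contribution
    [e `^ (a - s)] against the far-field one [e `^ (- s) * D]. *)
Lemma code_energy_error :
  `|code_energy - fine riesz_energy| <=
  (3 + near_const s a C + near_const s a packing_const) * D `^ (1 - s / a).
Proof.
have D0 : 0 < D by apply: lt_le_trans size_inv_le; rewrite invr_gt0.
pose e := D `^ a^-1; have e0 : 0 < e by rewrite powR_gt0.
set Q := D `^ (1 - s / a).
have eD : e `^ (- s) * D = Q.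
  rewrite -powRrM -{2}(powRr1 (ltW D0)) -powRD; last by rewrite (lt0r_neq0 D0) implybT.
  by congr (_ `^ _); rewrite mulrN addrC mulrC.
have eas : e `^ (a - s) = Q.
  by rewrite -powRrM; congr (_ `^ _); rewrite mulrBr mulVf ?lt0r_neq0// mulrC.
have h1 := code_energy_le e0; have h2 := code_energy_ge e0.
have h3 := trunc_energy_le e0.
have h4 : e `^ (- s) / (size Y)%:R <= Q.
  by rewrite -eD ler_wpM2l ?powR_ge0// size_inv_le.
have := riesz_energy_bounds e0; rewrite -(fineK riesz_energy_fin_num) !lee_fin.
move=> /andP[h5 h6]; move: h1 h2 h3 h6; rewrite /near_bound eas eD.
have Q0 : 0 <= Q by exact: powR_ge0.
have n2 : 0 <= near_const s a C * Q.
  by apply: mulr_ge0 => //; apply: near_const_ge0 => //; case/andP: s0a.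
have n3 : 0 <= near_const s a packing_const * Q.
  apply: mulr_ge0 => //; apply: near_const_ge0; last exact: packing_const_ge0.
  by case/andP: s0a.
rewrite -[fine _%:E]/(fine riesz_energy) in h5 *.
move: (fine riesz_energy) (near_const s a C) (near_const s a packing_const) n2 n3 h4 h5 Q0.
move: (\int[P]_x _) (trunc_energy e) code_energy (_ / _) (Q).
move=> I tE cE q Q' k1 k2 k3 n2 n3 h4 h5 Q0 h1 h2 h3 h6.
move: h3; rewrite !ler_distl => /andP[h3 h7].
rewrite !mulrDl; apply/andP; split; lra.
Qed.

End code.

End metric_probability.

(** * Lebesgue measure on row vectors *)

Lemma open_borel (T : ptopologicalType) (A : set T) :
  open A -> measurable (A : set (borel T)).
Proof. exact: sub_sigma_algebra. Qed.

Lemma rV_ballP {R : realType} n (p q : 'rV[R]_n) (r : R) :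
  ball p r q <-> 0 < r /\ forall j, `|p 0 j - q 0 j| < r.
Proof.
split=> [[r0 h]|[r0 h]]; first by split => // j; exact: (h 0 j).
by split => // i j; rewrite ord1; exact: h.
Qed.

(** Balls with rational centres and radii [k.+1^-1] form a countable base of
    the topology. *)
Lemma open_preimage_measurable {R : realType} disp (S : measurableType disp) n
    (f : S -> 'rV[R]_n) (O : set 'rV[R]_n) :
  (forall p r, 0 < r -> measurable (f @^-1` ball p r)) -> open O ->
  measurable (f @^-1` O).
Proof.
move=> mf oO.
pose B (qk : 'rV[rat]_n * nat) : set 'rV[R]_n :=
  ball (map_mx ratr qk.1 : 'rV[R]_n) qk.2.+1%:R^-1.
pose F qk := if `[< B qk `<=` O >] then f @^-1` B qk else set0.
have -> : f @^-1` O = \bigcup_qk F qk.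
  apply/seteqP; split => x /=; last first.
    by move=> [qk _]; rewrite /F; case: asboolP => // BO; exact: BO.
  move=> Ofx; have /nbhs_ballP[e /= e0 eO] : nbhs (f x) O by exact: open_nbhs_nbhs.
  have [k ke] : exists k : nat, k.+1%:R^-1 <= e / 2.
    have e2 : 0 < e / 2 by rewrite divr_gt0.
    exists (Num.truncn (e / 2)^-1); rewrite -[leRHS]invrK lef_pV2 ?posrE ?invr_gt0//.
    by rewrite ltW// truncnS_gt.
  have k0 : 0 < k.+1%:R^-1 :> R by rewrite invr_gt0.
  have /choice[q hq] : forall j : 'I_n, exists q : rat, `|f x 0 j - ratr q| < k.+1%:R^-1.
    move=> j; have [|q] := @rat_in_itvoo R (f x 0 j) (f x 0 j + k.+1%:R^-1).
      by rewrite ltrDl.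
    by rewrite in_itv/= => /andP[q1 q2]; exists q; rewrite distrC ger0_norm ?subr_ge0 ?(ltW q1)// ltrBlDl.
  exists (\row_j q j, k) => //; rewrite /F asboolT /=.
    by apply/rV_ballP; split => // j; rewrite !mxE distrC.
  move=> z /rV_ballP[_ zq]; apply: eO; apply/rV_ballP; split => // j.
  have := zq j; rewrite /= !mxE => h1; have h2 := hq j.
  rewrite -(subrKA (ratr (q j))) (le_lt_trans (ler_normD _ _))//.
  apply: (lt_le_trans (ltrD h2 h1)); apply: (le_trans (lerD ke ke)).
  by rewrite -splitr.
apply: countable_bigcupT_measurable => [|qk]; first exact: countableP.
rewrite /F; case: asboolP => // _.
by apply: mf; rewrite invr_gt0.
Qed.

Section lebesgue_step.
Context {R : realType} (n : nat).
Context (mu : {sigma_finite_measure set (borel 'rV[R]_n) -> \bar R}).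
Context (mu_ball : forall (p : 'rV[R]_n) (r : R), 0 < r ->
  mu (ball p r) = ((2 * r) ^+ n)%:E).

Definition rV_cons (p : measurableTypeR R * borel 'rV[R]_n) : borel 'rV[R]_n.+1 :=
  row_mx (p.1)%:M p.2 : 'rV[R]_(1 + n).

Lemma rV_cons0 p : rV_cons p 0 0 = p.1.
Proof.
transitivity (row_mx (p.1)%:M (p.2 : 'rV[R]_n) 0 (lshift n (0 : 'I_1))).
  by congr (_ _ _); exact/val_inj.
by rewrite row_mxEl mxE eqxx mulr1n.
Qed.

Lemma rV_consS p (j : 'I_n) : rV_cons p 0 (rshift 1 j) = p.2 0 j.
Proof. exact: row_mxEr. Qed.

Lemma rV_cons_ball (p : 'rV[R]_n.+1) r : 0 < r ->
  rV_cons @^-1` ball p r =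
  ball (p 0 0) r `*` ball (rsubmx (p : 'rV[R]_(1 + n))) r.
Proof.
move=> r0; apply/seteqP; split => -[x v] /=.
  move=> /rV_ballP[_ h]; split; first by have := h 0; rewrite rV_cons0.
  by apply/rV_ballP; split => // j; have := h (rshift 1 j); rewrite rV_consS mxE.
move=> [h1 /rV_ballP[_ h2]]; apply/rV_ballP; split => // j.
case: (@splitP 1 n j) => k jk.
  have -> : j = 0 by apply/val_inj; rewrite /= jk [k]ord1.
  by rewrite rV_cons0.
have -> : j = rshift 1 k by exact/val_inj.
by rewrite rV_consS; have := h2 k; rewrite mxE.
Qed.

Lemma measurable_rV_cons : measurable_fun setT rV_cons.
Proof.
apply: (@measurability _ _ _ (borel 'rV[R]_n.+1) setT _ (@open 'rV[R]_n.+1)) => //.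
move=> _ [A oA <-]; rewrite setTI.
apply: open_preimage_measurable oA => p r r0.
rewrite rV_cons_ball//; apply: measurableX; first exact: measurable_ball.
by apply: open_borel; exact: ball_open.
Qed.

Definition rV_measure := pushforward (lebesgue_measure \x mu)%E rV_cons.

Let rV_measure0 : rV_measure set0 = 0%E.
Proof. by rewrite /rV_measure /pushforward preimage_set0 measure0. Qed.

Let rV_measure_ge0 A : (0 <= rV_measure A)%E.
Proof. by apply: integral_ge0 => x _; exact: measure_ge0. Qed.

Let rV_measure_sigma_additive : semi_sigma_additive rV_measure.
Proof.
move=> F mF tF mUF; rewrite /rV_measure /pushforward preimage_bigcup.
apply: measure_semi_sigma_additive.
- by move=> n0; rewrite -[X in measurable X]setTI; exact: measurable_rV_cons.
- apply/trivIsetP => /= i j _ _ ij; rewrite -preimage_setI.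
  by move/trivIsetP : tF => /(_ _ _ _ _ ij) ->//; rewrite preimage_set0.
- by rewrite -preimage_bigcup -[X in measurable X]setTI; exact: measurable_rV_cons.
Qed.

HB.instance Definition _ := isMeasure.Build _ _ _ rV_measure
  rV_measure0 rV_measure_ge0 rV_measure_sigma_additive.

Lemma rV_measure_ball (p : 'rV[R]_n.+1) (r : R) : 0 < r ->
  rV_measure (ball p r) = ((2 * r) ^+ n.+1)%:E.
Proof.
move=> r0; rewrite /rV_measure /pushforward rV_cons_ball// product_measure1E.
- rewrite [X in (X * _)%E](lebesgue_measure_ball _ (ltW r0)).
  by rewrite [X in (_ * X)%E](mu_ball _ r0) -EFinM exprS mulr_natl.
- exact: measurable_ball.
- by apply: open_borel; exact: ball_open.
Qed.

Let rV_measure_sigma_finite : sigma_finite setT rV_measure.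
Proof.
exists (fun k => ball (0 : 'rV[R]_n.+1) k.+1%:R).
  apply/esym/seteqP; split => // v _.
  exists (Num.truncn `|v|) => //; rewrite -ball_normE /= sub0r normrN.
  exact: truncnS_gt.
move=> k; split; first by apply: open_borel; exact: ball_open.
by rewrite rV_measure_ball ?ltry// ltr0n.
Qed.

HB.instance Definition _ := Measure_isSigmaFinite.Build _ _ _ rV_measure
  rV_measure_sigma_finite.

End lebesgue_step.

(** The set function that iterates the product construction is a measure: at
    each step it is the image of a product measure under the concatenation of
    a coordinate and a row vector. *)
Lemma lebesgue_rV_measure (R : realType) n :
  exists mu : {sigma_finite_measure set (borel 'rV[R]_n) -> \bar R},
    (@lebesgue_rV R n = mu) /\
    forall (p : 'rV[R]_n) (r : R), 0 < r -> mu (ball p r) = ((2 * r) ^+ n)%:E.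
Proof.
elim: n => [|n [mu [muE mu_ball]]].
  exists (dirac (0 : borel 'rV[R]_0)); split => // p r r0.
  rewrite expr0 /= /dirac indicE mem_set//.
  by apply/rV_ballP; split => // -[].
exists (rV_measure mu); split; last exact: rV_measure_ball.
by rewrite /= muE.
Unshelve. all: exact: mu_ball. Qed.

(** * Limits of matrices and positive definite forms *)

Section matrix_limits.
Context {R : realType}.

Lemma mx_norm_le m n (A : 'M[R]_(m, n)) (b : R) : 0 <= b ->
  (forall i j, `|A i j| <= b) -> `|A| <= b.
Proof.
move=> b0 Ab; rewrite [leLHS]/Num.Def.normr/= mx_normrE.
by apply: bigmax_le => // -[i j] _; exact: Ab.
Qed.

Lemma mx_entry_le m n (A : 'M[R]_(m, n)) i j : `|A i j| <= `|A|.
Proof.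
rewrite [leRHS]/Num.Def.normr/= mx_normrE.
exact: (le_bigmax _ (fun ij : 'I_m * 'I_n => `|A ij.1 ij.2|) (i, j)).
Qed.

Lemma cvg_mx {T : Type} (F : set_system T) {FF : Filter F} m n
    (f : T -> 'M[R]_(m, n)) (A : 'M[R]_(m, n)) :
  (forall i j, f x i j @[x --> F] --> A i j) -> f x @[x --> F] --> A.
Proof.
move=> fA; apply/cvgrPdist_le => e e0; near=> x.
apply: mx_norm_le; first exact: ltW.
move=> i j; rewrite !mxE; move: i j; near: x.
apply: filter_forall => i; apply: filter_forall => j.
by move/cvgrPdist_le : (fA i j); exact.
Unshelve. all: by end_near. Qed.

Lemma cvg_entry {T : Type} (F : set_system T) {FF : Filter F} m n
    (f : T -> 'M[R]_(m, n)) (A : 'M[R]_(m, n)) i j :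
  f x @[x --> F] --> A -> f x i j @[x --> F] --> A i j.
Proof.
move=> fA; apply: (@cvg_comp _ _ _ f (fun M : 'M[R]_(m, n) => M i j) F (nbhs A)).
  exact: fA.
exact: coord_continuous.
Qed.

Lemma cvg_bigsum {T I : Type} (F : set_system T) {FF : Filter F} (r : seq I)
    (f : I -> T -> R) (a : I -> R) :
  (forall i, f i x @[x --> F] --> a i) ->
  \sum_(i <- r) f i x @[x --> F] --> \sum_(i <- r) a i.
Proof. by move=> fa; apply: cvg_big => //; exact: add_continuous. Qed.

Lemma cvg_bigprod {T I : Type} (F : set_system T) {FF : Filter F} (r : seq I)
    (f : I -> T -> R) (a : I -> R) :
  (forall i, f i x @[x --> F] --> a i) ->
  \prod_(i <- r) f i x @[x --> F] --> \prod_(i <- r) a i.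
Proof. by move=> fa; apply: cvg_big => //; exact: mul_continuous. Qed.

Lemma cvg_mulmx {T : Type} (F : set_system T) {FF : Filter F} m n p
    (f : T -> 'M[R]_(m, n)) (g : T -> 'M[R]_(n, p)) (A : 'M[R]_(m, n)) (B : 'M[R]_(n, p)) :
  f x @[x --> F] --> A -> g x @[x --> F] --> B ->
  f x *m g x @[x --> F] --> A *m B.
Proof.
move=> fA gB; apply: cvg_mx => i j.
rewrite [X in _ --> X]mxE; under eq_cvg do rewrite mxE.
by apply: cvg_bigsum => k; apply: cvgM; exact: cvg_entry.
Qed.

Lemma cvg_trmx {T : Type} (F : set_system T) {FF : Filter F} m n
    (f : T -> 'M[R]_(m, n)) (A : 'M[R]_(m, n)) :
  f x @[x --> F] --> A -> (f x)^T @[x --> F] --> A^T.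
Proof.
move=> fA; apply: cvg_mx => i j; rewrite mxE.
by under eq_cvg do rewrite mxE; exact: cvg_entry.
Qed.

Lemma cvg_det {T : Type} (F : set_system T) {FF : Filter F} n
    (f : T -> 'M[R]_n) (A : 'M[R]_n) :
  f x @[x --> F] --> A -> \det (f x) @[x --> F] --> \det A.
Proof.
move=> fA; apply: cvg_bigsum => s; apply: cvgM; first exact: cvg_cst.
by apply: cvg_bigprod => i; exact: cvg_entry.
Qed.

End matrix_limits.

Section positive_definite.
Context {R : realType} {n : nat}.
Implicit Types (G : 'M[R]_n) (v : 'rV[R]_n).

Definition qform G v : R := (v *m G *m v^T) 0 0.

Lemma qformE G v : qform G v = \sum_i \sum_j v 0 i * G i j * v 0 j.
Proof.
rewrite /qform mxE exchange_big/=; apply: eq_bigr => j _.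
by rewrite !mxE mulr_suml.
Qed.

Lemma qformZ G a v : qform G (a *: v) = a ^+ 2 * qform G v.
Proof.
rewrite !qformE mulr_sumr; apply: eq_bigr => i _.
by rewrite mulr_sumr; apply: eq_bigr => j _; rewrite !mxE; ring.
Qed.

Lemma qform_le G v : qform G v <= (n ^ 2)%:R * `|G| * `|v| ^+ 2.
Proof.
rewrite qformE (@le_trans _ _ (\sum_(i < n) \sum_(j < n) `|G| * `|v| ^+ 2))//.
  apply: ler_sum => i _; apply: ler_sum => j _.
  rewrite (le_trans (ler_norm _))// !normrM mulrAC mulrC.
  by rewrite !ler_pM ?mulr_ge0// ?mx_entry_le// expr2 ler_pM ?mx_entry_le.
by rewrite !sumr_const card_ord -mulrnA -[_ *+ _]mulr_natl mulnn mulrA.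
Qed.

Lemma qform_normr_le G v : `|qform G v| <= (n ^ 2)%:R * `|G| * `|v| ^+ 2.
Proof.
rewrite ler_norml qform_le andbT lerNl.
have -> : - qform G v = qform (- G) v by rewrite /qform mulmxN mulNmx !mxE.
by rewrite (le_trans (qform_le _ _))// normrN.
Qed.

Lemma qformD G H v : qform (G + H) v = qform G v + qform H v.
Proof. by rewrite /qform mulmxDr mulmxDl mxE. Qed.

Definition posdef G := forall v, v != 0 -> 0 < qform G v.

Lemma continuous_qform G : continuous (qform G).
Proof.
move=> v; apply: (@cvg_entry _ _ (nbhs v) _ _ _ _ (v *m G *m v^T)).
apply: cvg_mulmx; last by apply: cvg_trmx; exact: cvg_id.
by apply: cvg_mulmx; [exact: cvg_id|exact: cvg_cst].
Qed.

(** By homogeneity the infimum over the unit sphere, which is compact, is a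
    lower bound everywhere. *)
Lemma posdef_lower G : posdef G ->
  exists2 m : R, 0 < m & forall v, m * `|v| ^+ 2 <= qform G v.
Proof.
move=> Gpos; have [S0|/set0P[w wS]] := eqVneq [set v : 'rV[R]_n | `|v| = 1] set0.
  exists 1 => // v; have [->|v0] := eqVneq v 0.
    by rewrite normr0 expr0n mulr0 /qform mul0mx mul0mx mxE.
  exfalso; have : [set v : 'rV[R]_n | `|v| = 1] (`|v|^-1 *: v).
    by rewrite /= normrZ normfV normr_id mulVf ?normr_eq0.
  by rewrite S0.
have [|||c /set_mem cS cmin] := @EVT_min_rV R n (qform G) [set v | `|v| = 1].
- by exists w.
- apply: bounded_closed_compact.
    by exists 1; split => // M M1 v /= ->; exact: ltW.
  apply: (@preimage_closed _ _ (fun v : 'rV[R]_n => `|v|) [set 1]).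
    by move=> v _; exact: norm_continuous.
  exact: closed_eq.
- by apply: continuous_subspaceT; exact: continuous_qform.
have c0 : c != 0 by apply: contra_eq_neq cS => ->; rewrite normr0 eq_sym oner_eq0.
exists (qform G c); first exact: Gpos.
move=> v; have [->|v0] := eqVneq v 0.
  by rewrite normr0 expr0n mulr0 /qform mul0mx mul0mx mxE.
have := cmin (`|v|^-1 *: v); rewrite inE/= normrZ normfV normr_id mulVf ?normr_eq0//.
move=> /(_ erefl); rewrite qformZ exprVn mulrC ler_pdivlMr//.
by rewrite exprn_gt0// normr_gt0.
Qed.

Lemma posdef_unit G : posdef G -> \det G != 0.
Proof.
move=> Gpos; apply/negP => /det0P[v v0 vG].
by have := Gpos v v0; rewrite /qform vG mul0mx mxE ltxx.
Qed.

(** The determinant does not vanish on the segment from the identity to [G],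
    which consists of positive definite matrices. *)
Lemma posdef_det_gt0 G : posdef G -> 0 < \det G.
Proof.
move=> Gpos; pose H (t : R) : 'M[R]_n := (1 - t) *: 1%:M + t *: G.
have H0 : \det (H 0) = 1 by rewrite /H subr0 scale1r scale0r addr0 det1.
have H1 : \det (H 1) = \det G by rewrite /H subrr scale0r scale1r add0r.
have Hpos t : 0 <= t <= 1 -> posdef (H t).
  move=> /andP[t0 t1] v v0; rewrite qformD.
  have -> : qform ((1 - t) *: 1%:M) v = (1 - t) * qform 1%:M v.
    by rewrite /qform -scalemxAr -scalemxAl mxE.
  have -> : qform (t *: G) v = t * qform G v.
    by rewrite /qform -scalemxAr -scalemxAl mxE.
  have I0 : 0 < qform 1%:M v.
    rewrite /qform mulmx1 mxE.
    have [i vi0] : exists i, v 0 i != 0.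
      by move/rV0Pn : v0 => [i vi]; exists i.
    rewrite (bigD1 i)//= ltr_wpDr//.
      by apply: sumr_ge0 => j _; rewrite mxE -expr2 sqr_ge0.
    by rewrite mxE -expr2 exprn_even_gt0.
  have [->|tn0] := eqVneq t 0; first by rewrite subr0 mul1r mul0r addr0.
  rewrite ltr_wpDl//; first by rewrite mulr_ge0 ?subr_ge0// ltW.
  by rewrite mulr_gt0 ?Gpos// lt_neqAle eq_sym tn0.
have cH : continuous (fun t => \det (H t)).
  move=> t; apply: cvg_det; apply: cvgD.
    by apply: cvgZr_tmp; apply: cvgB; [exact: cvg_cst|exact: cvg_id].
  by apply: cvgZr_tmp; exact: cvg_id.
rewrite ltNge; apply/negP => detG.
have [|c c01 Hc] := @IVT R (fun t => \det (H t)) 0 1 0 ler01 (continuous_subspaceT cH).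
  by rewrite H0 H1 ge_min le_max detG ler01 orbT.
have := posdef_unit (Hpos c _); rewrite Hc eqxx.
by move: c01; rewrite in_itv/= => -> /(_ isT).
Qed.

End positive_definite.

(** * Directional derivatives and differentiability *)

Section differentiability.
Context {R : realType}.

Lemma is_derive_line (V W : normedModType R) (f : V -> W) (y v : V) (t : R) :
  derivable f (y + t *: v) v ->
  is_derive t 1 (fun t => f (y + t *: v)) ('D_v f (y + t *: v)).
Proof.
have E : (fun h : R => h^-1 *: (((fun t => f (y + t *: v)) \o shift t) (h *: 1) -
      f (y + t *: v))) =
    (fun h => h^-1 *: ((f \o shift (y + t *: v)) (h *: v) - f (y + t *: v))).
  apply/funext => h /=; congr (_ *: (f _ - _)).
  by rewrite scalerDl [h *: 1]mulr1 addrCA.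
move=> df; apply: DeriveDef.
  by rewrite /derivable E.
by rewrite /derive E.
Qed.

Lemma increment_le (V : normedModType R) (f : V -> R) (y v : V) (t c e : R) :
  (forall u : R, `|u| <= `|t| -> derivable f (y + u *: v) v) ->
  (forall u : R, `|u| <= `|t| -> `|'D_v f (y + u *: v) - c| <= e) ->
  `|f (y + t *: v) - f y - t * c| <= `|t| * e.
Proof.
move=> df Df; pose g u := f (y + u *: v); pose dg (u : R) : R := 'D_v f (y + u *: v).
have g0 : f y = g 0 by rewrite /g scale0r addr0.
have dgP (u : R) : `|u| <= `|t| -> is_derive u 1 g (dg u).
  by move=> ut; apply: is_derive_line; exact: df.
suff [u ut gE] : exists2 u : R, `|u| <= `|t| & g t - g 0 = dg u * t.
  rewrite g0 -[f (y + t *: v)]/(g t) gE [t * c]mulrC -mulrBl normrM mulrC.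
  by rewrite ler_wpM2l//; exact: Df.
have cg (a b : R) : (forall u : R, a <= u <= b -> `|u| <= `|t|) -> {within `[a, b], continuous g}.
  move=> h; apply: derivable_within_continuous => u; rewrite in_itv/= => /h ut.
  by have [] := dgP u ut.
have [t0|t0] := leP 0 t.
  have h u : 0 <= u <= t -> `|u| <= `|t|.
    by move=> /andP[u0 ut]; rewrite !ger0_norm.
  have [|u|u] := @MVT_segment R g dg 0 t t0; last by rewrite subr0 => ut ->; exists u => //; apply: h; rewrite in_itv in ut.
    by move=> u; rewrite in_itv/= => /andP[u0 ut]; apply/dgP/h; rewrite !ltW.
  exact: cg.
have h u : t <= u <= 0 -> `|u| <= `|t|.
  by move=> /andP[ut u0]; rewrite (ler0_norm u0) (ltr0_norm t0) lerN2.
have [|u|u] := @MVT_segment R g dg t 0 (ltW t0); last first.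
  move=> ut gE; exists u; first by apply: h; rewrite in_itv in ut.
  by rewrite -opprB gE sub0r mulrN opprK.
- by apply: cg.
- by move=> u; rewrite in_itv/= => /andP[u0 ut]; apply/dgP/h; rewrite !ltW.
Qed.

Lemma differentiable_of_bound (V W : normedModType R) (f : V -> W)
    (df : {linear V -> W}) (x : V) : continuous df ->
  (forall e : R, 0 < e ->
    \forall h \near (0 : V), `|f (h + x) - f x - df h| <= e * `|h|) ->
  differentiable f x.
Proof.
move=> cdf fdf.
suff E : f \o shift x = cst (f x) + df +o_ (0 : V) id.
  by apply/diff_locallyP; rewrite (diff_unique cdf E).
apply/eqaddoP => e e0; near=> h.
rewrite [_ h]/= opprD addrA; near: h; exact: fdf.
Unshelve. all: by end_near. Qed.

(** Along the path that changes one coordinate at a time, the mean value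
    theorem compares the increment of [f] with the partial derivatives. *)
Lemma partials_increment n m (f : 'rV[R]_n -> 'rV[R]_m) (p h : 'rV[R]_n)
    (J : 'M[R]_(n, m)) (e d : R) : 0 <= e -> `|h| < d ->
  (forall (x : 'rV[R]_n) (k : 'I_n), `|x - p| < d -> derivable f x (delta_mx 0 k)) ->
  (forall (x : 'rV[R]_n) (k : 'I_n), `|x - p| < d -> `|'D_(delta_mx 0 k) f x - row k J| <= e) ->
  `|f (p + h) - f p - h *m J| <= n%:R * `|h| * e.
Proof.
move=> e0 hd df Df; apply: mx_norm_le => [|i l]; first by rewrite !mulr_ge0.
rewrite ord1 {i}; pose s i : 'rV[R]_n := \row_j (if (j < i)%N then h 0 j else 0).
have s0 : s 0%N = 0 by apply/rowP => j; rewrite !mxE.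
have sn : s n = h by apply/rowP => j; rewrite mxE ltn_ord.
have sS (k : 'I_n) : s k.+1 = s k + h 0 k *: delta_mx 0 k.
  apply/rowP => j; rewrite !mxE eqxx/= ltnS leq_eqVlt.
  have [->|jk] := eqVneq j k; first by rewrite eqxx ltnn add0r mulr1.
  by rewrite (_ : (j == k :> nat) = false) ?mulr0 ?addr0//; exact/negbTE.
have near_s (k : 'I_n) (u : R) : `|u| <= `|h 0 k| ->
    `|p + s k + u *: delta_mx 0 k - p| < d.
  move=> uk; rewrite -[p + s k + _]addrA [p + _]addrC addrK; apply: le_lt_trans hd.
  apply: mx_norm_le => // i j; rewrite ord1 !mxE eqxx/=.
  have [->|jk] := eqVneq j k; last first.
    by rewrite mulr0 addr0; case: ifP; rewrite ?normr0// mx_entry_le.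
  by rewrite ltnn add0r mulr1 (le_trans uk)// mx_entry_le.
have step (k : 'I_n) : `|f (p + s k.+1) 0 l - f (p + s k) 0 l - h 0 k * J k l| <= `|h 0 k| * e.
  rewrite sS addrA; apply: (increment_le (f := fun x => f x 0 l)) => u uk.
    by have /derivable_mxP := df _ k (near_s k u uk); exact.
  have duk := df _ k (near_s k u uk).
  apply: le_trans (Df _ k (near_s k u uk)).
  have := mx_entry_le ('D_(delta_mx 0 k) f (p + s k + u *: delta_mx 0 k) - row k J) 0 l.
  by rewrite {1}(derive_mx duk) !mxE.
have -> : (f (p + h) - f p - h *m J) 0 l =
    \sum_(k < n) (f (p + s k.+1) 0 l - f (p + s k) 0 l - h 0 k * J k l).
  rewrite sumrB -(big_mkord xpredT (fun k => f (p + s k.+1) 0 l - f (p + s k) 0 l)).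
  by rewrite telescope_sumr// s0 sn addr0 !mxE.
rewrite (le_trans (ler_norm_sum _ _ _))//.
apply: (@le_trans _ _ (\sum_(k < n) `|h| * e)).
  apply: ler_sum => k _; rewrite (le_trans (step k))// ler_wpM2r//.
  exact: mx_entry_le.
by rewrite sumr_const card_ord -[_ *+ _]mulr_natl mulrA.
Qed.

(** This turns the continuity of the directional derivatives, by which the
    smoothness of the charts is expressed, into total differentiability. *)
Lemma partials_differentiable n m (f : 'rV[R]_n -> 'rV[R]_m) (p : 'rV[R]_n) :
  (forall k : 'I_n, \forall x \near p, derivable f x (delta_mx 0 k)) ->
  (forall k : 'I_n, {for p, continuous (fun x => 'D_(delta_mx 0 k) f x)}) ->
  differentiable f p.
Proof.
move=> df Df; pose J : 'M[R]_(n, m) := \matrix_(k, l) 'D_(delta_mx 0 k) f p 0 l.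
have rowJ k : row k J = 'D_(delta_mx 0 k) f p by apply/rowP => l; rewrite !mxE.
have cJ : continuous (mulmxr J : 'rV[R]_n -> 'rV[R]_m).
  move=> v; apply: (@cvg_mulmx _ _ (nbhs v) _ _ _ _ id (fun=> J) v J).
    exact: cvg_id.
  exact: cvg_cst.
apply: (@differentiable_of_bound _ _ f (mulmxr J) p cJ) => e e0; pose e' := e / n.+1%:R.
have e'0 : 0 < e' by rewrite divr_gt0.
have /nbhs_ballP[d /= d0 hd] : \forall x \near p, forall k : 'I_n,
    derivable f x (delta_mx 0 k) /\ `|'D_(delta_mx 0 k) f x - row k J| <= e'.
  apply: (@filter_forall _ _ (fun (k : 'I_n) x => derivable f x (delta_mx 0 k) /\
    `|'D_(delta_mx 0 k) f x - row k J| <= e') (nbhs p)) => k.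
  near=> x; split; first by near: x; exact: df.
  rewrite rowJ distrC; near: x.
  by have /cvgrPdist_le := Df k; exact.
near=> h.
have hlt : `|h| < d.
  near: h; apply/nbhs_ballP; exists d => // z.
  by rewrite -ball_normE /= sub0r normrN.
have := @partials_increment n m f p h J e' d (ltW e'0) hlt.
rewrite [h + p]addrC => /(_ _ _)/le_trans; apply.
- by move=> x k xp; case: (hd x _ k) => //; rewrite -ball_normE/= distrC.
- by move=> x k xp; case: (hd x _ k) => //; rewrite -ball_normE/= distrC.
rewrite mulrAC ler_wpM2r// /e' mulrA ler_pdivrMr// mulrC ler_pM2l// ler_nat//.
Unshelve. all: by end_near. Qed.

End differentiability.

Lemma closed_norm_ball {R : realType} (V : normedModType R) (p0 : V) (r : R) :
  closed [set p | `|p0 - p| <= r].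
Proof.
have -> : [set p | `|p0 - p| <= r] = (fun p => `|p0 - p|) @^-1` [set x | x <= r].
  by [].
apply: preimage_closed; last exact: closed_le.
move=> p _; suff : `|p0 - q| @[q --> p] --> `|p0 - p| by [].
by apply: cvg_norm; apply: cvgB; [exact: cvg_cst|exact: cvg_id].
Qed.

Section chain_rule.
Context {R : realType}.

Lemma derive_chain n m (f : R -> 'rV[R]_n) (h : 'rV[R]_n -> 'rV[R]_m) (t : R) :
  derivable f t 1 -> differentiable h (f t) ->
  derivable (h \o f) t 1 /\ 'D_1 (h \o f) t = 'D_1 f t *m 'J h (f t).
Proof.
move=> /derivable1_diffP df dh; have dhf := differentiable_comp df dh.
split; first exact/derivable1_diffP.
rewrite (deriveE _ dhf) (deriveE _ df) diff_comp//=.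
by rewrite /jacobian mul_rV_lin1.
Qed.

Lemma derive_scale n (f : R -> 'rV[R]_n) (t v : R) :
  derivable f t 1 -> derivable f t v /\ 'D_v f t = v *: 'D_1 f t.
Proof.
move=> /derivable1_diffP df; split; first exact: diff_derivable.
by rewrite !(deriveE _ df) -linearZ/= [v *: 1]mulr1.
Qed.

Lemma Ck1_curve n (U : set R) (f : R -> 'rV[R]_n) : open U ->
  (forall t, U t -> derivable f t 1) ->
  (forall t, U t -> {for t, continuous (fun t => 'D_1 f t)}) ->
  Ck_on 1 U f.
Proof.
move=> oU df Df; split.
  by move=> t Ut; apply: differentiable_continuous; apply/derivable1_diffP/df.
move=> v; split; first by move=> t /df/(derive_scale v)[].
split; last exact: I.
move=> t Ut.
have E : \forall u \near t, v *: 'D_1 f u = 'D_v f u.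
  near=> u; have Uu : U u by near: u; exact: open_nbhs_nbhs.
  by have [_ ->] := derive_scale v (df _ Uu).
suff : 'D_v f u @[u --> t] --> 'D_v f t by [].
rewrite -(nbhs_singleton E).
apply: (cvg_trans (near_eq_cvg E)).
by apply: cvgZl_tmp; exact: Df.
Unshelve. all: by end_near. Qed.

Lemma Ck1_curveP n (U : set R) (f : R -> 'rV[R]_n) : Ck_on 1 U f ->
  forall t, U t -> [/\ {for t, continuous f}, derivable f t 1 &
    {for t, continuous (fun t => 'D_1 f t)}].
Proof.
by move=> [cf /(_ 1)[df [Df _]]] t Ut; split; [exact: cf|exact: df|exact: Df].
Qed.

End chain_rule.

(** * Curves and their lengths *)

Section smooth_step.
Context {R : realType}.

(** A C1 curve is defined on the whole line. Parametrizing a segment by this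
    step, whose values stay between 0 and 1, keeps the curve at all times in the
    coordinate ball that contains its ends. *)
Definition step (t : R) : R := (1 - cos (pi * t)) / 2.

Lemma step0 : step 0 = 0. Proof. by rewrite /step mulr0 cos0 subrr mul0r. Qed.

Lemma step1 : step 1 = 1.
Proof. by rewrite /step mulr1 cospi opprK -[1 + 1]/(2%:R) divff. Qed.

Lemma step_itv t : 0 <= step t <= 1.
Proof.
have h1 := cos_le1 (pi * t); have h2 := cos_geN1 (pi * t).
by rewrite /step; apply/andP; split; lra.
Qed.

Definition dstep (t : R) : R := pi / 2 * sin (pi * t).

Lemma is_derive_step (t : R) : is_derive t (1 : R) step (dstep t).
Proof.
have dpi : is_derive t (1 : R) (fun t : R => pi * t) pi.
  have h : is_derive t (1 : R) (pi *: (id : R -> R)) (pi *: 1) by exact: is_deriveZ.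
  by rewrite [pi *: 1]mulr1 in h.
have dcos : is_derive t (1 : R) (fun t : R => cos (pi * t)) (- sin (pi * t) * pi).
  exact: (is_derive1_comp (f := cos) (g := fun t : R => pi * t)).
have h : is_derive t (1 : R) (2^-1 *: (cst 1 - (fun t : R => cos (pi * t)))) (2^-1 *: (0 - (- sin (pi * t) * pi))).
  exact: is_deriveZ.
have -> : step = 2^-1 *: (cst 1 - (fun t : R => cos (pi * t))).
  by apply/funext => u; rewrite /step mulrC.
have -> // : dstep t = 2^-1 *: (0 - (- sin (pi * t) * pi)).
by rewrite /dstep sub0r mulNr opprK -[RHS]/(_ * _); ring.
Qed.

Lemma dstep_le t : `|dstep t| <= 2.
Proof.
have s1 : `|sin (pi * t)| <= 1 by rewrite ler_norml sin_geN1 sin_le1.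
rewrite /dstep normrM ger0_norm ?divr_ge0 ?pi_ge0// -[leRHS]mulr1.
rewrite ler_pM ?divr_ge0 ?pi_ge0// ler_pdivrMr//.
by have := @pihalf_lt2 R; lra.
Qed.

Lemma continuous_dstep : continuous dstep.
Proof.
move=> t; apply: cvgM; first exact: cvg_cst.
have cpi : pi * u @[u --> t] --> pi * t by apply: cvgM; [exact: cvg_cst|exact: cvg_id].
exact: (@cvg_comp _ _ _ _ sin _ _ _ cpi (@continuous_sin R _)).
Qed.

End smooth_step.

Section charts.
Context {R : realType} {d : nat} {M : ptopologicalType}.
Context (g : riemannian_manifold R d M).
Local Notation dom := (chart_dom g).
Local Notation phi := (chart g).
Local Notation psi := (chart_inv g).

Lemma transition_near i j x : dom i x -> dom j x ->
  \forall p \near phi i x, (phi i @` (dom i `&` dom j)) p.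
Proof.
move=> ix jx; have pimg : (phi i @` dom i) (phi i x) by exists x.
have Oimg := open_nbhs_nbhs (conj (@chart_img_open _ _ _ g i) pimg).
have cpsi := chart_inv_continuous pimg.
have Oj : \forall p \near phi i x, dom j (psi i p).
  apply: cpsi; rewrite chartK//; apply: open_nbhs_nbhs; split => //.
  exact: chart_dom_open.
near=> p; have [y iy yp] : (phi i @` dom i) p by near: p; exact: Oimg.
exists y => //; split => //; rewrite -(chartK iy) yp.
by near: p; exact: Oj.
Unshelve. all: by end_near. Qed.

(** Smoothness is expressed by directional derivatives; the chain rule needs
    the total derivative of the transition maps. *)
Lemma transition_differentiable i j x : dom i x -> dom j x ->
  differentiable (phi j \o psi i) (phi i x).
Proof.
move=> ix jx; have Ix : (phi i @` (dom i `&` dom j)) (phi i x) by exists x.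
have [_ T1] := @transition_smooth _ _ _ g i j 1%N.
apply: partials_differentiable => k; last by case: (T1 (delta_mx 0 k)) => _ [h _]; exact: h.
near=> p; case: (T1 (delta_mx 0 k)) => h _; apply: h.
by near: p; exact: transition_near.
Unshelve. all: by end_near. Qed.

Lemma metric_continuous i x : dom i x -> {for phi i x, continuous (metric g i)}.
Proof. by move=> ix; have [h _] := @metric_smooth _ _ _ g i 0%N; apply: h; exists x. Qed.

Section curves.
Variable c : R -> M.
Hypothesis c_C1 : C1_curve g c.

Lemma C1_curve_near i t : dom i (c t) -> \forall u \near t, dom i (c u).
Proof.
move=> it; have cc := c_C1.1 t; apply: cc; apply: open_nbhs_nbhs; split => //.
exact: chart_dom_open.
Qed.

Lemma C1_curveP i t : dom i (c t) ->
  [/\ {for t, continuous (phi i \o c)}, derivable (phi i \o c) t 1 &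
    {for t, continuous (fun t => 'D_1 (phi i \o c) t)}].
Proof. by move=> it; exact: (Ck1_curveP (c_C1.2 i)). Qed.

Lemma velocity_transition i j t : dom i (c t) -> dom j (c t) ->
  'D_1 (phi j \o c) t = 'D_1 (phi i \o c) t *m 'J (phi j \o psi i) (phi i (c t)).
Proof.
move=> it jt; have [_ di _] := C1_curveP it.
have [_ <-] := derive_chain di (transition_differentiable it jt).
apply: near_eq_derive; near=> u; rewrite /= chartK//.
by near: u; exact: C1_curve_near.
Unshelve. all: by end_near. Qed.

(** The transition rules of the velocity and of the metric cancel, so that the
    speed, defined with the chart chosen at each point, can be computed in a
    fixed chart, where it is continuous in time. *)
Lemma speedE i t : dom i (c t) ->
  speed g c t = Num.sqrt (qform (metric g i (phi i (c t))) ('D_1 (phi i \o c) t)).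
Proof.
move=> it; rewrite /speed; set j := chart_at g (c t).
have jt : dom j (c t) by exact: chart_at_dom.
rewrite (velocity_transition it jt) /qform (metric_transition it jt).
by rewrite trmx_mul !mulmxA.
Qed.

Lemma continuous_speed : continuous (speed g c).
Proof.
move=> t; set i := chart_at g (c t).
have it : dom i (c t) by exact: chart_at_dom.
have [cf df Df] := C1_curveP it.
have E : \forall u \near t,
    Num.sqrt (qform (metric g i (phi i (c u))) ('D_1 (phi i \o c) u)) = speed g c u.
  by near=> u; rewrite (@speedE i)//; near: u; exact: C1_curve_near.
suff : speed g c u @[u --> t] --> speed g c t by [].
rewrite (speedE it); apply: (cvg_trans (near_eq_cvg E)).
apply: (@cvg_comp _ _ _ _ Num.sqrt _ _ _ _ (@sqrt_continuous R _)).
apply: (@cvg_entry _ _ (nbhs t)).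
apply: cvg_mulmx; last exact: cvg_trmx.
apply: cvg_mulmx; first exact: Df.
apply: (@cvg_comp _ _ _ (phi i \o c) (metric g i) _ (nbhs (phi i (c t)))).
  exact: cf.
exact: metric_continuous.
Unshelve. all: by end_near. Qed.

End curves.

Definition rev_curve (c : R -> M) (t : R) := c (1 - t).

Lemma is_derive_onem (t : R) : is_derive t 1 (fun t : R => 1 - t) (-1).
Proof.
have h : is_derive t 1 (cst 1 - id : R -> R) (0 - 1) by exact: is_deriveB.
by rewrite sub0r in h.
Qed.

Lemma derive_rev n (f : R -> 'rV[R]_n) (t : R) : derivable f (1 - t) 1 ->
  derivable (fun t : R => f (1 - t)) t 1 /\
  'D_1 (fun t : R => f (1 - t)) t = - 'D_1 f (1 - t).
Proof.
move=> /derivable1_diffP df.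
have dr : differentiable (fun t : R => 1 - t) t.
  by apply/derivable1_diffP; case: (is_derive_onem t).
have dfr := differentiable_comp dr df.
split; first exact/derivable1_diffP.
rewrite (deriveE _ dfr) diff_comp//= -(deriveE _ dr).
rewrite [X in 'd _ _ X](_ : _ = -1); last by case: (is_derive_onem t).
by rewrite linearN /= (deriveE _ df).
Qed.

Lemma C1_curve_rev c : C1_curve g c -> C1_curve g (rev_curve c).
Proof.
move=> cC1; have cr : continuous (fun t : R => 1 - t).
  by move=> t; apply: cvgB; [exact: cvg_cst|exact: cvg_id].
have cc : continuous (rev_curve c).
  by move=> t; apply: (@cvg_comp _ _ _ _ c _ _ _ (cr t)); exact: cC1.1.
split=> [|i]; [exact: cc|apply: Ck1_curve].
- by apply: open_comp => [t _|]; [exact: cc|exact: chart_dom_open].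
- by move=> t it; have [_ df _] := C1_curveP cC1 it; case: (derive_rev df).
- move=> t it; have [_ _ Df] := C1_curveP cC1 it.
  have E : \forall u \near t,
      - 'D_1 (phi i \o c) (1 - u) = 'D_1 (phi i \o rev_curve c) u.
    near=> u; have iu : dom i (c (1 - u)).
      near: u; apply: cc; apply: open_nbhs_nbhs; split => //.
      exact: chart_dom_open.
    have [_ df _] := C1_curveP cC1 iu.
    by have [_ <-] := derive_rev df.
  suff : 'D_1 (phi i \o rev_curve c) u @[u --> t] --> 'D_1 (phi i \o rev_curve c) t by [].
  rewrite -(nbhs_singleton E); apply: (cvg_trans (near_eq_cvg E)).
  apply: cvgN; apply: (@cvg_comp _ _ _ (fun t : R => 1 - t) (fun u => 'D_1 (phi i \o c) u) _ _ _ (cr t)).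
  exact: Df.
Unshelve. all: by end_near. Qed.

Lemma speed_rev c t : C1_curve g c -> speed g (rev_curve c) t = speed g c (1 - t).
Proof.
move=> cC1; rewrite /speed /rev_curve; set i := chart_at g _.
have it : dom i (c (1 - t)) by exact: chart_at_dom.
have [_ df _] := C1_curveP cC1 it.
have [_ E] := derive_rev df.
have -> : 'D_1 (phi i \o (fun t => c (1 - t))) t = - 'D_1 (phi i \o c) (1 - t).
  exact: E.
by rewrite linearN /= mulmxN mulNmx mulNmx opprK.
Qed.

Definition arc_length c : R := \int[lebesgue_measure]_(t in `[0, 1]) speed g c t.

Lemma arc_length_rev c : C1_curve g c -> arc_length (rev_curve c) = arc_length c.
Proof.
move=> cC1; have r01 : 0 <= (1 : R) <= 1 by rewrite lexx ler01.
have cs : {within `[0, 1], continuous (speed g (rev_curve c))}.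
  exact/continuous_subspaceT/(continuous_speed (C1_curve_rev cC1)).
apply: (etrans (Rintegration_by_substitution_onem r01 cs)).
rewrite {1}/unstable.onem subrr; apply: eq_Rintegral => t _.
by rewrite (speed_rev _ cC1) /unstable.onem opprB addrC subrK.
Qed.

Lemma integrable_speed c (a b : R) : C1_curve g c ->
  lebesgue_measure.-integrable `[a, b] (EFin \o speed g c).
Proof.
move=> cC1; apply: continuous_compact_integrable; first exact: segment_compact.
exact/continuous_subspaceT/continuous_speed.
Qed.

Lemma curve_length_ge0 s : 0 <= curve_length g s.
Proof.
by apply: sumr_ge0 => c _; apply: Rintegral_ge0 => t _; exact: sqrtr_ge0.
Qed.

Lemma curve_length_cons c s :
  curve_length g (c :: s) = arc_length c + curve_length g s.
Proof. by rewrite /curve_length big_cons. Qed.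

Lemma curve_length_cat s1 s2 :
  curve_length g (s1 ++ s2) = curve_length g s1 + curve_length g s2.
Proof. by rewrite /curve_length big_cat. Qed.

Lemma piecewise_cat s1 s2 x y z :
  piecewise_C1_from_to g s1 x y -> piecewise_C1_from_to g s2 y z ->
  piecewise_C1_from_to g (s1 ++ s2) x z.
Proof.
by elim: s1 x => [|c s1 IH] x /= => [->//|[cC1 cx h] h2]; split => //; exact: IH.
Qed.

Lemma piecewise_rev s x y : piecewise_C1_from_to g s x y ->
  exists2 s', piecewise_C1_from_to g s' y x & curve_length g s' = curve_length g s.
Proof.
elim: s x => [|c s IH] x /=; first by move=> ->; exists [::].
move=> [cC1 cx /IH[s' hs' Es']]; exists (s' ++ [:: rev_curve c]).
  apply: (piecewise_cat hs') => /=.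
  by split; [exact: C1_curve_rev|rewrite /rev_curve subr0|rewrite /rev_curve subrr].
by rewrite curve_length_cat Es' addrC !curve_length_cons (arc_length_rev cC1) [X in _ + X + _]big_nil addr0.
Qed.

Definition joinable x y := exists s, piecewise_C1_from_to g s x y.

Lemma joinable_sym x y : joinable x y -> joinable y x.
Proof. by move=> [s /piecewise_rev[s' h _]]; exists s'. Qed.

Lemma joinable_trans x y z : joinable x y -> joinable y z -> joinable x z.
Proof. by move=> [s1 h1] [s2 h2]; exists (s1 ++ s2); exact: piecewise_cat h2. Qed.

Lemma geodist_le s x y : piecewise_C1_from_to g s x y ->
  geodist g x y <= curve_length g s.
Proof.
move=> h; apply: ge_inf; last by exists s.
by exists 0 => _ [s' _ <-]; exact: curve_length_ge0.
Qed.

Lemma geodist_ge0 x y : 0 <= geodist g x y.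
Proof.
rewrite /geodist; set S := [set _ | _ in _].
have [->|/set0P S0] := eqVneq S set0; first by rewrite inf0.
by apply: lb_le_inf => // _ [s _ <-]; exact: curve_length_ge0.
Qed.

Lemma geodist_refl x : geodist g x x = 0.
Proof.
apply/eqP; rewrite eq_le geodist_ge0 andbT.
by have := @geodist_le [::] x x erefl; rewrite /curve_length big_nil.
Qed.

Lemma geodist_adherent x y (e : R) : joinable x y -> 0 < e ->
  exists2 s, piecewise_C1_from_to g s x y & curve_length g s < geodist g x y + e.
Proof.
move=> [s0 h0] e0.
have [|_ [s hs <-] lts] := @inf_adherent R
    [set curve_length g s | s in [set s | piecewise_C1_from_to g s x y]] e e0.
  split; first by exists (curve_length g s0), s0.
  by exists 0 => _ [s' _ <-]; exact: curve_length_ge0.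
by exists s.
Qed.

Lemma geodist_sym x y : joinable x y -> geodist g x y = geodist g y x.
Proof.
suff h a b : joinable a b -> geodist g a b <= geodist g b a.
  by move=> xy; apply/eqP; rewrite eq_le !h//; exact: joinable_sym.
move=> ab; apply/ler_addgt0Pr => e e0.
have [s hs lts] := geodist_adherent (joinable_sym ab) e0.
have [s' hs' E] := piecewise_rev hs.
by apply: le_trans (geodist_le hs') _; rewrite E ltW.
Qed.

Lemma geodist_triangle x y z : joinable x y -> joinable y z ->
  geodist g x z <= geodist g x y + geodist g y z.
Proof.
move=> xy yz; apply/ler_addgt0Pr => e e0.
have e2 : 0 < e / 2 by rewrite divr_gt0.
have [s hs lts] := geodist_adherent xy e2.
have [s' hs' lts'] := geodist_adherent yz e2.
apply: (le_trans (geodist_le (piecewise_cat hs hs'))).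
by rewrite curve_length_cat (splitr e) addrACA lerD ?ltW.
Qed.

(** * Comparison of geodesic balls with coordinate balls *)

(** A coordinate ball on which the metric is comparable to the sup norm, with
    constants [m] and [L], and the volume density lies between [a] and [b]. *)
Definition comparison_ball (i : chart_index g) (p0 : 'rV[R]_d) (r m L a b : R) :=
  forall p, ball p0 r p -> [/\ (phi i @` dom i) p,
    forall v, m * `|v| <= Num.sqrt (qform (metric g i p) v) <= L * `|v| &
    a <= Num.sqrt (\det (metric g i p)) <= b].

(** At the centre the metric is bounded below by positive definiteness. By
    continuity, on a small ball its matrices differ from the one at the centre by
    at most half this bound. *)
Lemma comparison_ball_exists i x : dom i x -> exists r m L a b : R,
  [/\ 0 < r, 0 < m, 0 < L, 0 < a & comparison_ball i (phi i x) r m L a b].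
Proof.
move=> ix; set p0 := phi i x; set G0 := metric g i p0.
have p0img : (phi i @` dom i) p0 by exists x.
have G0pos : posdef G0 by move=> v v0; exact: metric_pos.
have [m0 m00 m0le] := posdef_lower G0pos.
have cG : {for p0, continuous (metric g i)} by exact: metric_continuous.
pose eta := m0 / 2 / (d ^ 2).+1%:R.
have eta0 : 0 < eta by rewrite !divr_gt0.
have etad : (d ^ 2)%:R * eta <= m0 / 2.
  by rewrite /eta mulrA ler_pdivrMr// mulrC ler_pM2l ?divr_gt0// ler_nat.
pose D := Num.sqrt (\det G0).
have D0 : 0 < D by rewrite sqrtr_gt0; exact: posdef_det_gt0.
have /nbhs_ballP[r /= r0 hr] : \forall p \near p0, [/\ (phi i @` dom i) p,
    `|G0 - metric g i p| <= eta & `|D - Num.sqrt (\det (metric g i p))| <= D / 2].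
  near=> p; split.
  - near: p; apply: open_nbhs_nbhs; split => //; exact: chart_img_open.
  - near: p; by have /cvgrPdist_le := cG; exact.
  - near: p.
    have cdet : \det (metric g i p) @[p --> p0] --> \det G0.
      exact: (@cvg_det R _ (nbhs p0) _ d (metric g i) G0 cG).
    have : Num.sqrt (\det (metric g i p)) @[p --> p0] --> D.
      exact: (@cvg_comp _ _ _ _ Num.sqrt _ _ _ cdet (@sqrt_continuous R _)).
    by move=> /cvgrPdist_le; apply; rewrite divr_gt0.
pose L2 := (d ^ 2)%:R * (`|G0| + eta) + 1.
have L20 : 0 < L2 by rewrite ltr_wpDl// mulr_ge0 ?addr_ge0// ltW.
exists r, (Num.sqrt (m0 / 2)), (Num.sqrt L2), (D / 2), (2 * D).
split; rewrite ?sqrtr_gt0 ?divr_gt0// => p /hr[pimg Gp Dp]; split => //; last first.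
  by move: Dp; rewrite ler_distl => /andP[h1 h2]; apply/andP; split; lra.
move=> v; have GE : metric g i p = G0 + - (G0 - metric g i p).
  by rewrite opprB addrC subrK.
have dq : `|qform (- (G0 - metric g i p)) v| <= m0 / 2 * `|v| ^+ 2.
  rewrite (le_trans (qform_normr_le _ _))// normrN ler_wpM2r ?exprn_ge0//.
  by rewrite (le_trans _ etad)// ler_wpM2l.
have vE : Num.sqrt (`|v| ^+ 2) = `|v| by rewrite sqrtr_sqr normr_id.
rewrite -[X in _ * X <= _]vE -[X in _ <= _ * X]vE.
rewrite -!sqrtrM ?divr_ge0 ?(ltW m00) ?(ltW L20)//.
have qge : m0 / 2 * `|v| ^+ 2 <= qform (metric g i p) v.
  rewrite GE qformD; have := m0le v; move: dq; rewrite ler_norml => /andP[h1 _] h2.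
  rewrite (_ : m0 / 2 * `|v| ^+ 2 = m0 * `|v| ^+ 2 - m0 / 2 * `|v| ^+ 2); last by field.
  lra.
rewrite !ler_wsqrtr//= (le_trans (qform_le _ _))// ler_wpM2r ?exprn_ge0//.
rewrite (@le_trans _ _ ((d ^ 2)%:R * (`|G0| + eta)))// ?lerDl// ler_wpM2l//.
by rewrite GE (le_trans (ler_normD _ _))// normrN lerD2l.
Unshelve. all: by end_near. Qed.

Section segment.
Context (i : chart_index g) (p0 : 'rV[R]_d) (r m L a b : R).
Hypothesis cball : comparison_ball i p0 r m L a b.
Context (p q : 'rV[R]_d).
Hypothesis (pball : ball p0 r p) (qball : ball p0 r q).

Let line (t : R) : 'rV[R]_d := p + step t *: (q - p).

Let line_ball t : ball p0 r (line t).
Proof.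
move: pball qball; rewrite -ball_normE /= => hp hq.
have /andP[s0 s1] := step_itv t.
have -> : p0 - line t = (1 - step t) *: (p0 - p) + step t *: (p0 - q).
  by apply/rowP => j; rewrite !mxE; ring.
rewrite (le_lt_trans (ler_normD _ _))//.
rewrite (normrZ (1 - step t)) (normrZ (step t) (p0 - q)).
have s1' : 0 <= 1 - step t by rewrite subr_ge0.
rewrite (ger0_norm s0) (ger0_norm s1').
have [->|t0] := eqVneq (step t) 0; first by rewrite mul0r subr0 mul1r addr0.
rewrite [ltRHS](_ : r = (1 - step t) * r + step t * r); last by ring.
by rewrite ler_ltD ?ler_wpM2l ?subr_ge0 ?(ltW hp)// ltr_pM2l// lt_neqAle eq_sym t0.
Qed.

Let derive_line t : derivable line t 1 /\ 'D_1 line t = dstep t *: (q - p).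
Proof.
have [ds Ds] := is_derive_step t.
have dZ : differentiable (fun t => step t *: (q - p)) t.
  by apply: differentiableZl; apply/derivable1_diffP.
have h : is_derive t (1 : R) (cst p + (fun t => step t *: (q - p))) (0 + dstep t *: (q - p)).
  apply: is_deriveD; apply: DeriveDef; first exact: diff_derivable.
  rewrite (deriveE _ dZ) diffZl/=; last exact/derivable1_diffP.
  by rewrite -deriveE ?Ds//; exact/derivable1_diffP.
by case: h => h1 h2; split; rewrite // h2 add0r.
Qed.

Let continuous_line : continuous line.
Proof.
move=> t; apply: differentiable_continuous; apply/derivable1_diffP.
by case: (derive_line t).
Qed.

Let c : R -> M := psi i \o line.

Let cP t : dom i (c t) /\ phi i (c t) = line t.
Proof.
have [[y iy yl] _ _] := cball (line_ball t).
by rewrite /c /= -yl chartK.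
Qed.

Let continuous_c : continuous c.
Proof.
move=> t; have [limg _ _] := cball (line_ball t).
apply: (@cvg_comp _ _ _ line (psi i) _ (nbhs (line t))).
  exact: continuous_line.
exact: chart_inv_continuous limg.
Qed.

Let C1_c : C1_curve g c.
Proof.
split=> [|j]; first exact: continuous_c.
have oU : open (c @^-1` dom j).
  by apply: open_comp => [t _|]; [exact: continuous_c|exact: chart_dom_open].
have chain t : dom j (c t) -> derivable (phi j \o c) t 1 /\
    'D_1 (phi j \o c) t = dstep t *: 'D_(q - p) (phi j \o psi i) (line t).
  move=> jt; have [it lt] := cP t.
  have := transition_differentiable it jt; rewrite lt => dT.
  have [dl Dl] := derive_line t; have [h1 h2] := derive_chain dl dT.
  by split; [exact: h1|rewrite (deriveEjacobian _ dT) scalemxAl -Dl; exact: h2].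
apply: Ck1_curve => // t jt; first by case: (chain t jt).
have E : \forall u \near t,
    dstep u *: 'D_(q - p) (phi j \o psi i) (line u) = 'D_1 (phi j \o c) u.
  near=> u; have ju : dom j (c u) by near: u; exact: (open_nbhs_nbhs (conj oU jt)).
  by case: (chain u ju).
suff : 'D_1 (phi j \o c) u @[u --> t] --> 'D_1 (phi j \o c) t by [].
rewrite -(nbhs_singleton E); apply: (cvg_trans (near_eq_cvg E)).
have cD : 'D_(q - p) (phi j \o psi i) (line u) @[u --> t] -->
    'D_(q - p) (phi j \o psi i) (line t).
  apply: (@cvg_comp _ _ _ line ('D_(q - p) (phi j \o psi i)) _ (nbhs (line t))).
    exact: continuous_line.
  have [it lt] := cP t; have [_ T1] := @transition_smooth _ _ _ g i j 1%N.
  case: (T1 (q - p)) => _ [h _]; apply: h.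
  by exists (c t).
have cd : dstep u @[u --> t] --> dstep t by exact: continuous_dstep.
exact: (@cvgZ _ _ _ (nbhs t) _ dstep (fun u => 'D_(q - p) (phi j \o psi i) (line u)) _ _ cd cD).
Unshelve. all: by end_near. Qed.

(** The curve that is a segment in the coordinates; the factor 2 bounds the
    derivative of the step. *)
Lemma segment_curve : exists c', [/\ C1_curve g c', c' 0 = psi i p,
  c' 1 = psi i q & arc_length c' <= 2 * L * `|q - p|].
Proof.
exists c; split => //.
- by rewrite /c /= /line step0 scale0r addr0.
- by rewrite /c /= /line step1 scale1r addrC subrK.
have sp t : speed g c t <= 2 * L * `|q - p|.
  have [it lt] := cP t; rewrite (speedE C1_c it) lt.
  have -> : phi i \o c = line by apply/funext => u; case: (cP u).
  have [_ ->] := derive_line t.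
  have [_ /(_ (dstep t *: (q - p)))/andP[_ h] _] := cball (line_ball t).
  apply: (le_trans h); rewrite normrZ.
  have L0 : 0 <= L * `|q - p|.
    have [_ /(_ (q - p))/andP[_ h'] _] := cball (line_ball t).
    exact: le_trans (sqrtr_ge0 _) h'.
  by rewrite mulrCA -mulrA ler_wpM2r// dstep_le.
have i1 := integrable_speed 0 1 C1_c.
apply: (@le_trans _ _ (\int[lebesgue_measure]_(t in `[0, 1]) (2 * L * `|q - p|))).
  apply: le_Rintegral => //.
  apply: continuous_compact_integrable; first exact: segment_compact.
  by apply: continuous_subspaceT => x; exact: cvg_cst.
by rewrite Rintegral_cst//= lebesgue_measure_itv/= lte01 oppr0 adde0 mulr1.
Qed.

End segment.

Lemma chart_ball_open i (p0 : 'rV[R]_d) (r : R) :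
  open [set x | dom i x /\ ball p0 r (phi i x)].
Proof.
rewrite openE => x [ix bx]; near=> y; split.
  by near: y; apply: open_nbhs_nbhs; split => //; exact: chart_dom_open.
near: y; apply: (chart_continuous ix); apply: open_nbhs_nbhs; split => //.
exact: ball_open.
Unshelve. all: by end_near. Qed.

Section confinement.
Context (i : chart_index g) (p0 : 'rV[R]_d) (r m L a b : R).
Hypothesis (m0 : 0 < m) (cball : comparison_ball i p0 r m L a b).

Let A := [set x | dom i x /\ ball p0 r (phi i x)].

Lemma coord_increment c (t1 : R) : C1_curve g c -> 0 <= t1 ->
  (forall t, 0 <= t <= t1 -> A (c t)) ->
  m * `|phi i (c t1) - phi i (c 0)| <=
  \int[lebesgue_measure]_(t in `[0, t1]) speed g c t.
Proof.
move=> cC1; rewrite le_eqVlt => /predU1P[<- _|t10 Ac].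
  by rewrite subrr normr0 mulr0; apply: Rintegral_ge0 => t _; exact: sqrtr_ge0.
set I := (X in _ <= X).
have I0 : 0 <= I by apply: Rintegral_ge0 => t _; exact: sqrtr_ge0.
rewrite mulrC -ler_pdivlMr//; apply: mx_norm_le; first by rewrite divr_ge0// ltW.
move=> o j; rewrite ord1 {o} !mxE.
pose f (t : R) : R := ('D_1 (phi i \o c) t) 0 j.
pose F (t : R) : R := phi i (c t) 0 j.
have Fd t : 0 <= t <= t1 -> is_derive t (1 : R) F (f t).
  move=> /Ac[it _]; have [_ dc _] := C1_curveP cC1 it.
  apply: DeriveDef; first by move/derivable_mxP : dc; exact.
  by rewrite /f (derive_mx dc) mxE.
have cF t : 0 <= t <= t1 -> F u @[u --> t] --> F t.
  by move=> /Fd[dF _]; apply: differentiable_continuous; apply/derivable1_diffP.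
have cf : {within `[0, t1], continuous f}.
  apply: continuous_in_subspaceT => t; rewrite inE /= in_itv /= => /Ac[it _].
  have [_ _ Dc] := C1_curveP cC1 it.
  exact: (@cvg_entry _ _ (nbhs t) _ _ _ _ _ _ _ Dc).
have oo t : t \in `]0, t1[ -> 0 <= t <= t1.
  by rewrite in_itv/= => /andP[u0 u1]; rewrite !ltW.
have e0 : 0 <= (0 : R) <= t1 by rewrite lexx ltW.
have e1 : 0 <= t1 <= t1 by rewrite lexx ltW.
have FTC : F t1 - F 0 = \int[lebesgue_measure]_(t in `[0, t1]) f t.
  rewrite /Rintegral (continuous_FTC2 t10 cf (F := F))//.
  - split.
    + by move=> t /oo/Fd[].
    + by apply: cvg_at_right_filter; exact: cF.
    + by apply: cvg_at_left_filter; exact: cF.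
  - by move=> t /oo/Fd[_ h]; rewrite derive1E.
have intf : lebesgue_measure.-integrable `[0, t1] (EFin \o f).
  by apply: continuous_compact_integrable; [exact: segment_compact|exact: cf].
have ints := integrable_speed 0 t1 cC1.
rewrite -[phi i (c t1) 0 j]/(F t1) -[phi i (c 0) 0 j]/(F 0) FTC.
apply: (le_trans (le_normr_Rintegral _ intf)) => //.
rewrite /I -RintegralZr//; apply: le_Rintegral => //.
- exact: integrable_norm.
- rewrite (_ : EFin \o _ = (fun t => (speed g c t)%:E * m^-1%:E)%E)//.
  exact: integrableZr.
move=> t; rewrite /= in_itv /= => tt1; have [it bt] := Ac t tt1.
rewrite ler_pdivlMr// (speedE cC1 it).
have [_ /(_ ('D_1 (phi i \o c) t))/andP[h _] _] := cball bt.
by apply: le_trans h; rewrite mulrC ler_pM2l// mx_entry_le.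
Qed.

Lemma arc_length_mono c (t : R) : C1_curve g c -> 0 <= t <= 1 ->
  \int[lebesgue_measure]_(t in `[0, t]) speed g c t <= arc_length c.
Proof.
move=> cC1 /andP[t0 t1]; rewrite /arc_length -subr_ge0.
rewrite Rintegral_itvB ?bnd_simp//; last exact: integrable_speed.
by apply: Rintegral_ge0 => u _; exact: sqrtr_ge0.
Qed.

(** At its first exit time from the coordinate ball, a curve would lie in a
    smaller closed coordinate ball, which is compact, hence closed in [M] since
    [M] is Hausdorff. *)
Lemma curve_confined c : C1_curve g c -> dom i (c 0) ->
  `|phi i (c 0) - p0| + arc_length c / m < r ->
  dom i (c 1) /\ m * `|phi i (c 1) - phi i (c 0)| <= arc_length c.
Proof.
move=> cC1 i0 lt_r; set rho := `|phi i (c 0) - p0| + _ in lt_r.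
have len0 : 0 <= arc_length c by apply: Rintegral_ge0 => t _; exact: sqrtr_ge0.
have A0 : A (c 0).
  split => //; rewrite -ball_normE /= distrC; apply: le_lt_trans lt_r.
  by rewrite lerDl divr_ge0// ltW.
suff Ac t : 0 <= t <= 1 -> A (c t).
  have e1 : 0 <= (1 : R) <= 1 by rewrite lexx ler01.
  by split; [case: (Ac _ e1)|exact: (coord_increment cC1 ler01 Ac)].
pose E := [set t : R | 0 <= t <= 1 /\ ~ A (c t)].
move=> t01; apply: contrapT => nAt.
have Einf : has_inf E by split; [exists t|exists 0 => u [/andP[]]].
pose tau := inf E.
have tau_lb u : E u -> tau <= u by apply: ge_inf; exact: Einf.2.
have tau0 : 0 <= tau by apply: lb_le_inf => [|u [/andP[]]//]; exists t.
have tau1 : tau <= 1 by apply: le_trans (tau_lb t _) _ => //; case/andP: t01.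
have before u : 0 <= u < tau -> A (c u).
  move=> /andP[u0 ut]; apply: contrapT => nAu.
  have : E u by split => //; rewrite u0 ltW// (lt_le_trans ut).
  by move=> /tau_lb; rewrite leNgt ut.
have rho0 : 0 <= rho by rewrite addr_ge0// divr_ge0// ltW.
have in_ball p : `|p0 - p| <= rho -> ball p0 r p.
  by move=> h; rewrite -ball_normE /=; exact: le_lt_trans lt_r.
have K_closed : closed [set psi i p | p in [set p | `|p0 - p| <= rho]].
  apply: compact_closed; first exact: (manifold_hausdorff g).
  apply: continuous_compact.
    apply: continuous_in_subspaceT => p; rewrite inE /= => /in_ball/cball[pimg _ _].
    exact: chart_inv_continuous pimg.
  apply: bounded_closed_compact.
    exists (`|p0| + rho); split; first exact: num_real.
    move=> x xlt p /= hp; rewrite ltW// (le_lt_trans _ xlt)//.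
    rewrite -[p](subKr p0) (le_trans (ler_normB _ _))// lerD2l//.
  exact: closed_norm_ball.
have Atau : A (c tau).
  move: tau0; rewrite le_eqVlt => /predU1P[<-//|tau0].
  have : [set psi i p | p in [set p | `|p0 - p| <= rho]] (c tau).
    have ctau : c u @[u --> tau^'-] --> c tau by apply: cvg_at_left_filter; exact: cC1.1.
    apply: (@closed_cvg _ _ _ _ c _ K_closed _ _ ctau).
    near=> u; have u0 : 0 <= u by near: u; exact: nbhs_left_ge.
    have ut : u < tau by near: u; exact: nbhs_left_lt.
    have [iu bu] : A (c u) by apply: before; rewrite u0.
    exists (phi i (c u)); last exact: chartK.
    rewrite /= distrC -(subrKA (phi i (c 0))) (le_trans (ler_normD _ _))// addrC lerD2l.
    rewrite ler_pdivlMr// mulrC.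
    apply: le_trans (arc_length_mono cC1 (_ : 0 <= u <= 1)).
      apply: coord_increment => // v /andP[v0 vu]; apply: before.
      by rewrite v0 (le_lt_trans vu).
    by rewrite u0 ltW// (lt_le_trans ut).
  move=> [p /in_ball bp <-]; have [[y iy yp] _ _] := cball bp.
  by rewrite -yp chartK//; split => //; rewrite yp.
have : \forall u \near tau, A (c u).
  by apply: (cC1.1 tau); apply: open_nbhs_nbhs; split => //; exact: chart_ball_open.
move=> /nbhs_ballP[e /= e0 he].
have [u Eu ult] := inf_adherent e0 Einf.
have tu := tau_lb u Eu; case: Eu => _; apply; apply: he.
by rewrite -ball_normE /= distrC ger0_norm ?subr_ge0// ltrBlDl.
Unshelve. all: by end_near. Qed.

Lemma piecewise_confined s x y : piecewise_C1_from_to g s x y -> dom i x ->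
  `|phi i x - p0| + curve_length g s / m < r ->
  dom i y /\ m * `|phi i y - phi i x| <= curve_length g s.
Proof.
elim: s x => [|c s IH] x /=.
  by move=> -> iy _; rewrite subrr normr0 mulr0 curve_length_ge0.
move=> [cC1 cx h] ix; rewrite curve_length_cons mulrDl => lt_r.
have s0 : 0 <= curve_length g s / m by rewrite divr_ge0 ?curve_length_ge0// ltW.
rewrite -cx in ix lt_r *.
have [|i1 h1] := curve_confined cC1 ix.
  by apply: le_lt_trans lt_r; rewrite lerD2l lerDl.
have h1' : `|phi i (c 1) - phi i (c 0)| <= arc_length c / m.
  by rewrite ler_pdivlMr// mulrC.
have [|iy hy] := IH _ h i1.
  apply: le_lt_trans lt_r; rewrite addrA lerD2r.
  rewrite [leRHS]addrC -(subrKA (phi i (c 0))).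
  by rewrite (le_trans (ler_normD _ _))// lerD2r.
split => //; rewrite -(subrKA (phi i (c 1))).
rewrite (le_trans (ler_wpM2l (ltW m0) (ler_normD _ _)))// mulrDr.
by rewrite addrC lerD.
Qed.

(** Short curves cannot leave the comparison ball, so a geodesic ball of small
    radius lies in a coordinate ball. *)
Lemma geoball_in_chart x y (t : R) : joinable x y -> dom i x ->
  `|phi i x - p0| + t / m < r -> geodist g x y < t ->
  dom i y /\ m * `|phi i y - phi i x| < t.
Proof.
move=> xy ix lt_r dt.
have e0 : 0 < t - geodist g x y by rewrite subr_gt0.
have [s hs] := geodist_adherent xy e0; rewrite addrC subrK => st.
have [|iy h] := piecewise_confined hs ix.
  by apply: le_lt_trans lt_r; rewrite lerD2l ler_pM2r ?invr_gt0// ltW.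
by split => //; exact: le_lt_trans st.
Qed.

End confinement.

End charts.

(** * Topology of the geodesic distance *)

Section distance_topology.
Context {R : realType} {d : nat} {M : ptopologicalType}.
Context (g : riemannian_manifold R d M).
Local Notation dom := (chart_dom g).
Local Notation phi := (chart g).
Local Notation psi := (chart_inv g).

Lemma comparison_ball_join i (p0 : 'rV[R]_d) (r m L a b : R) x y :
  comparison_ball i p0 r m L a b ->
  dom i x -> ball p0 r (phi i x) -> dom i y -> ball p0 r (phi i y) ->
  joinable g x y /\ geodist g x y <= 2 * L * `|phi i y - phi i x|.
Proof.
move=> cball ix bx iy yb.
have [c [cC1 c0 c1 len]] := segment_curve cball bx yb.
have h : piecewise_C1_from_to g [:: c] x y.
  by split; rewrite // ?c0 ?c1 chartK.
split; first by exists [:: c].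
apply: le_trans (geodist_le h) _.
by rewrite curve_length_cons /curve_length big_nil addr0.
Qed.

Lemma geodist_near x (e : R) : 0 < e ->
  \forall y \near x, joinable g x y /\ geodist g x y < e.
Proof.
move=> e0; set i := chart_at g x.
have ix : dom i x by exact: chart_at_dom.
have [r [m [L [a [b [r0 m0 L0 a0 cball]]]]]] := comparison_ball_exists ix.
pose t := Num.min r (e / (2 * L)).
have t0 : 0 < t by rewrite lt_min r0 divr_gt0// mulr_gt0.
have xt : [set y | dom i y /\ ball (phi i x) t (phi i y)] x.
  by split => //; exact: ballxx.
apply: filterS (open_nbhs_nbhs (conj (chart_ball_open i (phi i x) t) xt)).
move=> y [iy yt].
have yr : ball (phi i x) r (phi i y) by apply: le_ball yt; rewrite ge_min lexx.
have [j dle] := comparison_ball_join cball ix (ballxx _ r0) iy yr.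
split => //; apply: (le_lt_trans dle).
rewrite mulrC -ltr_pdivlMr ?mulr_gt0// distrC.
move: yt; rewrite -ball_normE /= => /lt_le_trans; apply.
by rewrite ge_min lexx orbT.
Qed.

Lemma geodist_open (A : set M) :
  (forall x, A x -> exists2 r : R, 0 < r & forall y, geodist g x y < r -> A y) ->
  open A.
Proof.
move=> hA; rewrite openE => x /hA[r r0 h].
by apply: filterS (geodist_near x r0) => y [_ /h].
Qed.

Context (M_connected : connected [set: M]).

(** The points joined to [x] form a set that is open, as is its complement. *)
Lemma joinable_all x y : joinable g x y.
Proof.
pose B := [set y | joinable g x y].
suff : B = setT by move=> BT; have : B y by rewrite BT.
have oB : open B.
  rewrite openE => z xz; apply: filterS (geodist_near z ltr01) => w [zw _].
  exact: joinable_trans zw.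
have oCB : open (~` B).
  rewrite openE => z nxz; apply: filterS (geodist_near z ltr01) => w [zw _] xw.
  by apply: nxz; exact: joinable_trans xw (joinable_sym zw).
apply: M_connected.
- by exists x; exists [::].
- by exists B; rewrite ?setTI.
- exists B; rewrite ?setTI//; rewrite -[B]setCK; exact: open_closedC.
Qed.

Lemma geoball_open x (r : R) : open (geoball g x r).
Proof.
apply: geodist_open => y yr; exists (r - geodist g x y); first by rewrite subr_gt0.
move=> z; rewrite ltrBrDl => h; apply: le_lt_trans h.
by apply: geodist_triangle; exact: joinable_all.
Qed.

End distance_topology.

Lemma continuous_in_borel {R : realType} (T : ptopologicalType) (D : set T) (f : T -> R) :
  open D -> (forall x, D x -> {for x, continuous f}) ->
  measurable_fun (D : set (borel T)) f.
Proof.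
move=> oD cf; apply: (measurability (@RGenOInfty.G R)).
  exact: RGenOInfty.measurableE.
move=> _ [_ [r ->] <-]; apply: open_borel.
rewrite openE => x [Dx]; rewrite /= in_itv /= andbT => rx.
have fr H := @cvgr_gt _ _ _ H f (f x) (cf x Dx) r rx.
have fr' := fr (nbhs_filter x); have nD := open_nbhs_nbhs (conj oD Dx).
apply: (filterS _ (filterI nD fr')) => y [Dy ry]; split; first exact: Dy.
by rewrite /= in_itv /= andbT.
Qed.

(** * Volumes of geodesic balls *)

Section volume.
Context {R : realType} {d : nat} {M : ptopologicalType}.
Context (g : riemannian_manifold R d M).
Context (lambda : {measure set (borel M) -> \bar R}).
Context (lambda_volume : riemannian_volume g lambda).
Local Notation dom := (chart_dom g).
Local Notation phi := (chart g).
Local Notation psi := (chart_inv g).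

(** The volume density is between [a] and [b] on a comparison ball, and the
    Lebesgue measure of a ball of radius [t] for the sup norm is [(2 * t) ^+ d]. *)
Lemma volume_chart_ball i (p0 : 'rV[R]_d) (r m L a b : R) (p : 'rV[R]_d) (t : R) :
  0 < a -> comparison_ball i p0 r m L a b -> 0 < t -> ball p t `<=` ball p0 r ->
  ((a * (2 * t) ^+ d)%:E <=
   lambda [set x | dom i x /\ ball p t (phi i x)] <= (b * (2 * t) ^+ d)%:E)%E.
Proof.
move=> a0 cball t0 sub; set S := [set x | _].
have mS : measurable (S : set (borel M)) by apply: open_borel; exact: chart_ball_open.
have imS : phi i @` S = ball p t.
  apply/seteqP; split => [_ [x [_ bx] <-]//|q bq].
  have [[y iy yq] _ _] := cball q (sub q bq).
  by exists y => //; split => //; rewrite yq.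
have [mu [muE mu_ball]] := lebesgue_rV_measure R d.
have mB : measurable (ball p t : set (borel 'rV[R]_d)).
  by apply: open_borel; exact: ball_open.
have Sdom : S `<=` dom i by move=> x [].
rewrite (lambda_volume mS Sdom) imS muE.
have mdens : measurable_fun (ball p t : set (borel 'rV[R]_d))
    (fun q => (Num.sqrt (\det (metric g i q)))%:E).
  apply/measurable_EFinP; apply: continuous_in_borel; first exact: ball_open.
  move=> q bq; have [[y iy yq] _ _] := cball q (sub q bq).
  have cG : {for q, continuous (metric g i)} by rewrite -yq; exact: metric_continuous.
  have cdet : \det (metric g i u) @[u --> q] --> \det (metric g i q).
    exact: (@cvg_det R _ (nbhs q) _ d (metric g i) _ cG).
  exact: (@cvg_comp _ _ _ _ Num.sqrt _ _ _ cdet (@sqrt_continuous R _)).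
have cstE (k : R) : (\int[mu]_(q in ball p t) k%:E = (k * (2 * t) ^+ d)%:E)%E.
  by rewrite integral_cst//= mu_ball.
rewrite -!cstE; apply/andP; split.
  apply: ge0_le_integral => //.
  - by move=> q _; rewrite lee_fin ltW.
  - by move=> q bq; rewrite lee_fin; have [_ _ /andP[]] := cball q (sub q bq).
apply: ge0_le_integral => //.
by move=> q bq; rewrite lee_fin; have [_ _ /andP[]] := cball q (sub q bq).
Qed.

Context (M_connected : connected [set: M]).

(** On a comparison ball, a geodesic ball lies between two coordinate balls
    whose radii are multiples of its own. *)
Lemma volume_geoball_near (x0 : M) : exists c C t0 : R, [/\ 0 < c, 0 < t0 &
  \forall x \near x0, forall t : R, 0 < t <= t0 ->
    ((c * t ^+ d)%:E <= lambda (geoball g x t) <= (C * t ^+ d)%:E)%E].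
Proof.
set i := chart_at g x0; have ix0 : dom i x0 by exact: chart_at_dom.
have [r [m [L [a [b [r0 m0 L0 a0 cball]]]]]] := comparison_ball_exists ix0.
set p0 := phi i x0 in cball.
have r4 : 0 < r / 4 by rewrite divr_gt0.
exists (a / L ^+ d), (b * (2 / m) ^+ d), (Num.min (m * (r / 4)) (2 * L * (r / 4))).
split; first by rewrite divr_gt0// exprn_gt0.
  by rewrite lt_min !mulr_gt0.
have xr : [set y | dom i y /\ ball p0 (r / 2) (phi i y)] x0.
  by split => //; apply: ballxx; rewrite divr_gt0.
apply: filterS (open_nbhs_nbhs (conj (chart_ball_open i p0 (r / 2)) xr)).
move=> x [ix]; rewrite -ball_normE /= => bx t /andP[t0].
rewrite le_min => /andP[tm tL].
have tm' : t / m <= r / 4 by rewrite ler_pdivrMr// mulrC.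
have tL' : t / (2 * L) <= r / 4 by rewrite ler_pdivrMr ?mulr_gt0// mulrC.
have sub u : u <= r / 4 -> ball (phi i x) u `<=` ball p0 r.
  move=> ur q; rewrite -!ball_normE /= => qu.
  rewrite -(subrKA (phi i x)) (le_lt_trans (ler_normD _ _))//; lra.
have tm0 : 0 < t / m by rewrite divr_gt0.
have tL0 : 0 < t / (2 * L) by rewrite divr_gt0// mulr_gt0.
have /andP[_ up] := volume_chart_ball a0 cball tm0 (sub _ tm').
have /andP[low _] := volume_chart_ball a0 cball tL0 (sub _ tL').
have mgeo : measurable (geoball g x t : set (borel M)).
  by apply: open_borel; exact: geoball_open.
have mball u : measurable ([set y | dom i y /\ ball (phi i x) u (phi i y)] : set (borel M)).
  by apply: open_borel; exact: chart_ball_open.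
apply/andP; split.
  rewrite (_ : a / L ^+ d * t ^+ d = a * (2 * (t / (2 * L))) ^+ d); last first.
    rewrite -mulrA mulrC -exprVn -exprMn mulrC; congr (_ * _ ^+ _).
    by field; exact: lt0r_neq0.
  apply: (le_trans low); apply: le_measure; rewrite ?inE//.
  move=> y [iy yb]; rewrite /geoball /=.
  have bx' : ball p0 r (phi i x) by rewrite -ball_normE /=; lra.
  have by' := sub _ tL' _ yb.
  have [_ dle] := comparison_ball_join cball ix bx' iy by'.
  apply: (le_lt_trans dle); rewrite mulrC -ltr_pdivlMr ?mulr_gt0// distrC.
  by move: yb; rewrite -ball_normE.
rewrite (_ : b * (2 / m) ^+ d * t ^+ d = b * (2 * (t / m)) ^+ d); last first.
  by rewrite -mulrA -exprMn; congr (_ * _ ^+ _); field; exact: lt0r_neq0.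
apply: le_trans up; apply: le_measure; rewrite ?inE//.
move=> y yt; have := geoball_in_chart m0 cball (joinable_all g M_connected x y) ix _ yt.
case=> [|iy h]; first by rewrite distrC; lra.
by split => //; rewrite -ball_normE /= distrC ltr_pdivlMr// mulrC.
Qed.

Context (M_compact : compact [set: M]).

(** Compactness makes the constants uniform. The three constants are replaced by
    a single integer, which is taken to infinity along a near-covering. *)
Lemma volume_geoball : exists c C t0 : R, [/\ 0 < c, 0 <= C, 0 < t0 &
  forall (x : M) (t : R), 0 < t <= t0 ->
    ((c * t ^+ d)%:E <= lambda (geoball g x t) <= (C * t ^+ d)%:E)%E].
Proof.
pose Q (n : nat) (x : M) := forall t : R, 0 < t <= n.+1%:R^-1 ->
  ((n.+1%:R^-1 * t ^+ d)%:E <= lambda (geoball g x t) <= (n.+1%:R * t ^+ d)%:E)%E.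
suff [n hn] : exists n, forall x, Q n x.
  exists n.+1%:R^-1, n.+1%:R, n.+1%:R^-1.
  by split => //.
have /compact_near_coveringP/(_ nat \oo Q _) := M_compact.
case=> [x0 _|n _ h]; last by exists n => x; apply: (h n) => //=.
have [c [C [t0 [c0 t00 hx]]]] := volume_geoball_near x0.
exists ([set x : M | forall t : R, 0 < t <= t0 ->
    ((c * t ^+ d)%:E <= lambda (geoball g x t) <= (C * t ^+ d)%:E)%E],
  [set n | Num.truncn c^-1 + Num.truncn C + Num.truncn t0^-1 <= n]%N).
  split => //=; exists (Num.truncn c^-1 + Num.truncn C + Num.truncn t0^-1)%N => //.
move=> [x n] [/= hxt hn] t /andP[tt0 tn].
have trle (u : R) k : (Num.truncn u <= k)%N -> u <= k.+1%:R.
  move=> uk; apply: ltW; apply: (lt_le_trans (truncnS_gt _)).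
  by rewrite ler_nat.
have nc : n.+1%:R^-1 <= c.
  rewrite -[leRHS]invrK lef_pV2 ?posrE ?invr_gt0//; apply: trle.
  by apply: leq_trans hn; rewrite -addnA leq_addr.
have nC : C <= n.+1%:R.
  by apply: trle; apply: leq_trans hn; rewrite addnAC leq_addl.
have nt0 : n.+1%:R^-1 <= t0.
  rewrite -[leRHS]invrK lef_pV2 ?posrE ?invr_gt0//; apply: trle.
  by apply: leq_trans hn; rewrite leq_addl.
have /andP[h1 h2] : ((c * t ^+ d)%:E <= lambda (geoball g x t) <= (C * t ^+ d)%:E)%E.
  by apply: hxt; rewrite tt0 (le_trans tn).
have td : 0 <= t ^+ d by rewrite exprn_ge0// ltW.
apply/andP; split.
  by apply: le_trans h1; rewrite lee_fin ler_wpM2r.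
by apply: (le_trans h2); rewrite lee_fin ler_wpM2r.
Qed.

Lemma volume_finite : (lambda [set: M] < +oo)%E.
Proof.
have /choice[S hS] (x : M) : exists S : set M,
    [/\ open S, S x & (lambda S < +oo)%E].
  set i := chart_at g x; have ix : dom i x by exact: chart_at_dom.
  have [r [m [L [a [b [r0 m0 L0 a0 cball]]]]]] := comparison_ball_exists ix.
  exists [set y | dom i y /\ ball (phi i x) r (phi i y)]; split.
  - exact: chart_ball_open.
  - by split => //; exact: ballxx.
  - have /andP[_ h] := volume_chart_ball a0 cball r0 (@subset_refl _ _).
    by apply: le_lt_trans h _; rewrite ltry.
move: M_compact; rewrite compact_cover => /(_ M setT S)[||D _ cover].
- by move=> x _; case: (hS x).
- by move=> x _; exists x => //; case: (hS x).
have mS x : measurable (S x : set (borel M)) by apply: open_borel; case: (hS x).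
have fin (s : seq M) : measurable (\big[setU/set0]_(x <- s) S x : set (borel M)) /\
    (lambda (\big[setU/set0]_(x <- s) S x) < +oo)%E.
  elim: s => [|x s [ms IH]]; first by rewrite big_nil measure0.
  rewrite big_cons; split; first exact: measurableU.
  apply: (le_lt_trans (measureU2 _ _ _)) => //.
  by rewrite lte_add_pinfty//; case: (hS x).
apply: (le_lt_trans _ (fin (finmap.enum_fset D)).2).
apply: le_measure; rewrite ?inE//; first exact: (fin _).1.
by move=> x /cover; rewrite -bigcup_fset.
Qed.

End volume.

Section normalized.
Context {R : realType} {d : nat} {M : ptopologicalType}.
Context (g : riemannian_manifold R d M).
Context (lambda : {measure set (borel M) -> \bar R}).
Context (lambda_volume : riemannian_volume g lambda).
Context (M_compact : compact [set: M]) (M_connected : connected [set: M]).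
Local Notation sigma := (normalized_volume lambda).

Let measurable_geoball x (r : R) : measurable (geoball g x r : set (borel M)).
Proof. by apply: open_borel; exact: geoball_open. Qed.

Lemma volume_gt0 : (0 < lambda [set: M])%E.
Proof.
have [c [C [t0 [c0 C0 t00 h]]]] := volume_geoball lambda_volume M_connected M_compact.
have t0t0 : 0 < t0 <= t0 by rewrite t00 lexx.
have /andP[h1 _] := h point t0 t0t0.
apply: lt_le_trans (le_trans h1 _); first by rewrite lte_fin mulr_gt0// exprn_gt0.
by apply: le_measure; rewrite ?inE.
Qed.

Lemma normalized_volumeE (A : set (borel M)) : measurable A ->
  fine (sigma A) = fine (lambda A) / fine (lambda [set: M]).
Proof.
move=> mA; have l0 := volume_gt0.
have loo := volume_finite lambda_volume M_compact.
rewrite /normalized_volume /= /mnormalize gt_eqF//= lt_eqF//=.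
rewrite fineM//; rewrite ge0_fin_numE//.
by apply: le_lt_trans loo; apply: le_measure; rewrite ?inE.
Qed.

(** Balls whose radius is bounded below cause no difficulty because the total
    mass is 1. *)
Lemma normalized_volume_ball_le : exists2 C : R, 0 <= C &
  forall x (r : R), 0 < r -> fine (sigma (geoball g x r)) <= C * r `^ d%:R.
Proof.
have [c [C [t0 [c0 C0 t00 h]]]] := volume_geoball lambda_volume M_connected M_compact.
have l0 := volume_gt0; have loo := volume_finite lambda_volume M_compact.
have L0 : 0 < fine (lambda [set: M]) by rewrite fine_gt0// l0.
have fin x (r : R) : lambda (geoball g x r) \is a fin_num.
  rewrite ge0_fin_numE//; apply: le_lt_trans loo; apply: le_measure; rewrite ?inE//.
exists (C / fine (lambda [set: M]) + (t0 ^+ d)^-1).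
  by rewrite addr_ge0// ?divr_ge0 ?invr_ge0 ?exprn_ge0// ltW.
move=> x r r0; rewrite powR_mulrn ?(ltW r0)// mulrDl.
have [rt|tr] := leP r t0.
  rewrite normalized_volumeE//.
  have /andP[_ hr] : _ := h x r (introT andP (conj r0 rt)).
  rewrite ler_wpDr ?mulr_ge0 ?invr_ge0 ?exprn_ge0 ?(ltW t00) ?(ltW r0)//.
  rewrite mulrAC ler_pM2r ?invr_gt0//.
  by rewrite -lee_fin fineK.
apply: (@le_trans _ _ 1).
  rewrite -lee_fin fineK; first exact: probability_le1.
  exact: fin_num_measure.
rewrite ler_wpDl ?mulr_ge0 ?invr_ge0 ?exprn_ge0 ?(ltW L0) ?(ltW r0)//.
by rewrite mulrC ler_pdivlMr ?exprn_gt0// mul1r lerXn2r ?nnegrE ?(ltW t00) ?(ltW r0)// ltW.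
Qed.

(** The upper bound on the radii is arbitrary because a large ball contains a
    small one. *)
Lemma normalized_volume_ball_ge (gam : R) : 0 < gam -> exists2 c : R, 0 < c &
  forall x (r : R), 0 < r <= gam -> c * r `^ d%:R <= fine (sigma (geoball g x r)).
Proof.
move=> gam0.
have [c [C [t0 [c0 C0 t00 h]]]] := volume_geoball lambda_volume M_connected M_compact.
have l0 := volume_gt0; have loo := volume_finite lambda_volume M_compact.
have L0 : 0 < fine (lambda [set: M]) by rewrite fine_gt0// l0.
have fin x (r : R) : lambda (geoball g x r) \is a fin_num.
  rewrite ge0_fin_numE//; apply: le_lt_trans loo; apply: le_measure; rewrite ?inE//.
(* Balls of radius larger than [t0] contain the ball of radius [q * r]. *)
pose q := Num.min 1 (t0 / gam).
have q0 : 0 < q by rewrite lt_min ltr01 divr_gt0.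
exists (c * q ^+ d / fine (lambda [set: M])).
  by rewrite divr_gt0// mulr_gt0// exprn_gt0.
move=> x r /andP[r0 rg]; rewrite powR_mulrn ?(ltW r0)// normalized_volumeE//.
rewrite mulrAC ler_pM2r ?invr_gt0// -mulrA -exprMn.
have qr0 : 0 < q * r by rewrite mulr_gt0.
have qrt : q * r <= t0.
  rewrite (@le_trans _ _ (t0 / gam * gam))//; last by rewrite divfK// gt_eqF.
  by rewrite ler_pM ?(ltW q0) ?(ltW r0)// ge_min lexx orbT.
have /andP[hr _] : _ := h x (q * r) (introT andP (conj qr0 qrt)).
rewrite -lee_fin fineK//; apply: (le_trans hr).
apply: le_measure; rewrite ?inE// => y; rewrite /geoball /= => /lt_le_trans; apply.
by rewrite ler_piMl ?(ltW r0)// ge_min lexx.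
Qed.

End normalized.

(** * Energies of codes on a manifold *)

Lemma card_fset_filter (T : choiceType) (Y : {fset T}) (A : set T) :
  #|` [fset x in Y | x \in A]%fset| = (\sum_(x <- Y) (x \in A))%N.
Proof.
rewrite card_fset_sum1 -big_fset_condE/= big_mkcond.
by apply: eq_bigr => x _; case: (x \in A).
Qed.

Section code_terms.
Context {R : realType} {d : nat} {M : ptopologicalType}.
Context (g : riemannian_manifold R d M).
Context (lambda : {measure set (borel M) -> \bar R}).
Local Notation sigma := (normalized_volume lambda).

(** The set whose supremum is the discrepancy is bounded by 1, so that the
    supremum is an upper bound of it. *)
Lemma discrepancy_ball (Y : {fset M}) y (r : R) : (0 < #|` Y|)%N ->
  (forall x (t : R), measurable (geoball g x t : set (borel M))) -> 0 < r ->
  `|mean (Y : seq (borel M)) (fun z => (geodist g y z < r)%R%:R) -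
    fine (sigma (geoball g y r))| <= discrepancy g lambda Y.
Proof.
move=> Y0 mB r0.
pose mY x (t : R) : R := mean (Y : seq (borel M)) (fun z => (geodist g x z < t)%R%:R).
have meanE x (t : R) : mY x t =
    #|` [fset z in Y | z \in geoball g x t]%fset|%:R / #|` Y|%:R :> R.
  rewrite /mY /mean card_fset_filter natr_sum; congr (_ / _).
  by apply: eq_bigr => z _; rewrite mem_setE.
have prob x t : 0 <= fine (sigma (geoball g x t)) <= 1.
  have fs : sigma (geoball g x t) \is a fin_num by exact: fin_num_measure.
  by rewrite fine_ge0// -lee_fin fineK// probability_le1.
have m01 x (t : R) : 0 <= mY x t <= 1.
  rewrite -[X in _ <= _ <= X](@mean_cst R _ (borel M) (Y : seq (borel M)) 1)// le_mean ?andbT.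
    by rewrite /mY /mean divr_ge0// sumr_ge0.
  by move=> z _; rewrite lern1 leq_b1.
rewrite -[mean _ _]/(mY y r); apply: ub_le_sup.
  exists 1 => _ [x [t [t0 ->]]]; rewrite -meanE.
  have /andP[h1 h2] := prob x t; have /andP[h3 h4] := m01 x t.
  by rewrite ler_norml; apply/andP; split; lra.
by exists y, r; split; rewrite // meanE.
Qed.

End code_terms.

Theorem theorem1 (R : realType) (d : nat) (M : ptopologicalType)
    (g : riemannian_manifold R d M)
    (lambda : {measure set (borel M) -> \bar R})
    (s : R) (X : nat -> {fset M}) (delta : nat -> R)
    (d_ge1 : (1 <= d)%N)
    (M_compact : compact [set: M]) (M_connected : connected [set: M])
    (lambda_volume : riemannian_volume g lambda)
    (s_range : 0 < s < d%:R)
    (X_admissible : admissible_with g lambda X delta)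
    (X_well_separated : well_separated g X) :
  let E_M := continuous_energy g lambda (riesz s) in
  let error l := `| discrete_energy g (X l) (riesz s) - fine E_M | in
  [/\ E_M \is a fin_num,
      (fun l => error l : R^o) =O_\oo
        (fun l => delta #|` X l| `^ ((1 - s / d%:R) / (d%:R + 2 - s / d%:R)) : R^o) &
      error @ \oo --> 0].
Proof.
move=> E_M error.
have [C C0 ball_le] := normalized_volume_ball_le lambda_volume M_compact M_connected.
have mB x (t : R) : measurable (geoball g x t : set (borel M)).
  by apply: open_borel; exact: geoball_open.
have dsym x y : geodist g x y = geodist g y x.
  by apply: geodist_sym; exact: joinable_all.
have dtri x y z : geodist g x z <= geodist g x y + geodist g y z.
  by apply: geodist_triangle; exact: joinable_all.
have dopen (A : set (borel M)) :
    (forall x, A x -> exists2 r : R, 0 < r & forall y, geodist g x y < r -> A y) ->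
    measurable A.
  by move=> hA; apply: open_borel; exact: geodist_open hA.
have E_fin : E_M \is a fin_num.
  have := @riesz_energy_fin_num R _ (borel M) (normalized_volume lambda) (geodist g) (geodist_ge0 g) dsym dtri dopen s d%:R C s_range C0 ball_le.
  exact.
have d0 : 0 < d%:R :> R by rewrite ltr0n.
have [X_card [delta_itv [_ delta_cvg]] X_disc _] := X_admissible.
have [gam gam0 X_sep] := X_well_separated.
have [c c0 ball_ge] := normalized_volume_ball_ge lambda_volume M_compact M_connected gam0.
set w := (1 - s / d%:R) / (d%:R + 2 - s / d%:R).
have sd0 : 0 < 1 - s / d%:R.
  by rewrite subr_gt0 ltr_pdivrMr// mul1r; case/andP: s_range.
have den : 1 <= d%:R + 2 - s / d%:R.
  have : 0 <= d%:R :> R by []. 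
  lra.
have w0 : 0 < w by rewrite divr_gt0// (lt_le_trans _ den).
have wle : w <= 1 - s / d%:R by rewrite ler_pdivrMr ?(lt_le_trans _ den)// ler_peMr// ltW.
pose K : R := 3 + near_const s d%:R C + near_const s d%:R (packing_const d%:R C c gam).
have K0 : 0 <= K.
  have sd : s < d%:R by case/andP: s_range.
  rewrite !addr_ge0 ?near_const_ge0// packing_const_ge0//.
have bound l : (0 < #|` X l|)%N -> error l <= K * delta #|` X l| `^ w.
  move=> Xl0; set D := delta _.
  have /andP[D0 D1] : 0 < D <= 1 by exact: delta_itv.
  have disc y (r : R) : 0 < r ->
      `|mean (X l : seq (borel M)) (fun z => (geodist g y z < r)%R%:R) -
        fine (normalized_volume lambda [set z | geodist g y z < r])| <= D.
    move=> r0; apply: ltW; apply: le_lt_trans (X_disc l).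
    exact: discrepancy_ball.
  have sep x y : x \in (X l : seq (borel M)) -> y \in (X l : seq (borel M)) -> x != y ->
      gam * (size (X l : seq (borel M)))%:R `^ (- d%:R^-1) < geodist g x y.
    exact: X_sep.
  have := @code_energy_error R _ (borel M) (normalized_volume lambda) (geodist g)
    (geodist_ge0 g) (geodist_refl g) dsym dtri dopen
    s d%:R C s_range C0 ball_le c gam c0 gam0 ball_ge (X l) D (fset_uniq (X l)) Xl0 sep disc.
  move=> /le_trans; apply; rewrite ler_wpM2l//.
  (* As [D <= 1], the exponent [1 - s / d] can be lowered to [w]. *)
  by apply: ger_powR => //; rewrite D0.
have X_large : \forall l \near \oo, (0 < #|` X l|)%N.
  by exact: (X_card _ (nbhs_infty_gt 0)).
split => //.
  apply/eqOP; near=> k; near=> l.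
  rewrite normr_id (@ger0_norm _ (_ `^ _)) ?powR_ge0//.
  apply: (le_trans (bound l _)); first by near: l; exact: X_large.
  by rewrite ler_wpM2r ?powR_ge0//; near: k; exact: nbhs_pinfty_ge.
apply/cvgrPdist_le => e e0.
have eta0 : 0 < (e / (K + 1)) `^ w^-1 by rewrite powR_gt0// divr_gt0// ltr_wpDl.
have dX : delta #|` X l| @[l --> \oo] --> 0 by exact: (cvg_comp _ _ X_card delta_cvg).
near=> l; rewrite sub0r normrN normr_id.
have Xl0 : (0 < #|` X l|)%N by near: l; exact: X_large.
apply: (le_trans (bound l Xl0)).
have /andP[D0 _] := delta_itv _ Xl0.
have De : delta #|` X l| <= (e / (K + 1)) `^ w^-1.
  have : `|0 - delta #|` X l| | <= (e / (K + 1)) `^ w^-1.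
    by near: l; move/cvgrPdist_le : dX; exact.
  by rewrite sub0r normrN gtr0_norm.
have K1 : 0 < K + 1 by rewrite ltr_wpDl.
apply: (@le_trans _ _ (K * (e / (K + 1)))).
  rewrite ler_wpM2l//; have := @ge0_ler_powR R w (ltW w0) _ _ _ _ De.
  rewrite -powRrM mulVf ?gt_eqF// powRr1 ?divr_ge0 ?(ltW e0) ?(ltW K1)//.
  by apply; rewrite nnegrE ?powR_ge0 ?ltW.
by rewrite mulrA ler_pdivrMr// mulrC ler_pM2l// lerDl.
Unshelve. all: by end_near. Qed.
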